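(* Let $I=(u_1,\ldots,u_q,v)$ be an almost complete intersection monomial ideal of $R=K[x_1,\ldots,x_n]$. Then $R/I$ is Cohen-Macaulay if and only if $I$ is non-dominant (i.e. $I$ is not a dominant ideal).
   Context: $K$ is a field and $R=K[x_1,\ldots,x_n]$ is the polynomial ring. For a monomial ideal $I$ of $R$, $G(I)$ denotes its unique minimal set of monomial generators. $I$ is a complete intersection if $\operatorname{height}(I)=|G(I)|$, and an almost complete intersection if $\operatorname{height}(I)=|G(I)|-1$. Convention: writing that $I=(u_1,\ldots,u_q,v)$ is an almost complete intersection monomial ideal means that $G(I)=\{u_1,\ldots,u_q,v\}$ has $q+1$ elements, that $\operatorname{height}(I)=q$, and that $(u_1,\ldots,u_q)$ is a complete intersection monomial ideal. A monomial ideal $I$ is dominant if for every monomial $m\in G(I)$ there is a variable $x_k$ whose exponent in $m$ is strictly greater than its exponent in every other element of $G(I)$. *)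

(* Defs.v *)
From HB Require Import structures.
From mathcomp Require Import all_boot all_order all_algebra.
From mathcomp.multinomials Require Import mpoly.

Set Implicit Arguments.
Unset Strict Implicit.
Unset Printing Implicit Defensive.

Import GRing.Theory.
Local Open Scope ring_scope.

Section CommutativeAlgebra.

(* [idealr A] and [prime_idealr A] are the types of proper ideals and
   of prime ideals, given by boolean membership predicates. *)
Variable A : comNzRingType.

Definition in_ideal (s : seq A) (x : A) : Prop :=
  exists c : 'I_(size s) -> A, x = \sum_(i < size s) c i * s`_i.

(* Properness is part of [idealr]. *)
Definition maximal_ideal (M : idealr A) : Prop :=
  forall J : idealr A, {subset M <= J} -> {subset J <= M}.

Definition prime_chain (k : nat) (c : nat -> prime_idealr A) : Prop :=
  forall i, (i < k)%N -> {subset c i <= c i.+1} /\ ~ {subset c i.+1 <= c i}.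

Definition chain_below (P : prime_idealr A) (k : nat) : Prop :=
  exists2 c : nat -> prime_idealr A, prime_chain k c & c k =i P.

Definition prime_height (P : prime_idealr A) (h : nat) : Prop :=
  chain_below P h /\ forall k, chain_below P k -> (k <= h)%N.

(* The minimum of the heights of the primes containing I; such a prime may a
   priori have infinite height, so the lower bound is stated with chains. *)
Definition height (I : idealr A) (h : nat) : Prop :=
  (exists2 P : prime_idealr A, {subset I <= P} & prime_height P h) /\
  (forall P : prime_idealr A, {subset I <= P} -> chain_below P h).

Definition regular_sequence (s : seq A) : Prop :=
  (forall (i : nat) (a : A), (i < size s)%N ->
     in_ideal (take i s) (s`_i * a) -> in_ideal (take i s) a) /\
  ~ in_ideal s 1.

Definition regular_sequence_in (I : idealr A) (s : seq A) : Prop :=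
  {subset s <= I} /\ regular_sequence s.

(* depth(I, A), also called the grade of I. *)
Definition depth (I : idealr A) (d : nat) : Prop :=
  (exists2 s : seq A, regular_sequence_in I s & size s = d) /\
  (forall s : seq A, regular_sequence_in I s -> (size s <= d)%N).

(* For a Noetherian ring A (such as a quotient of K[x_1,...,x_n]):
   depth(M, A) = height(M) for every maximal ideal M.  This is the definition
   of Eisenbud, Commutative Algebra, Section 18.2. *)
Definition cohen_macaulay : Prop :=
  forall M : idealr A, maximal_ideal M -> exists2 h, height M h & depth M h.

End CommutativeAlgebra.

Section MonomialIdeals.

Variables (K : fieldType) (n : nat).

Definition generated_by (G : seq 'X_{1..n}) (I : idealr {mpoly K[n]}) : Prop :=
  forall p, p \in I <-> in_ideal [seq 'X_[m] | m <- G] p.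

(* The elements of G, without repetition, are those of G(I).  In particular I
   is a monomial ideal. *)
Definition minimal_generators (I : idealr {mpoly K[n]})
    (G : seq 'X_{1..n}) : Prop :=
  [/\ uniq G, generated_by G I
    & forall G' : seq 'X_{1..n},
        {subset G' <= G} -> generated_by G' I -> {subset G <= G'}].

Definition complete_intersection (I : idealr {mpoly K[n]}) : Prop :=
  exists2 G, minimal_generators I G & height I (size G).

(* I = (u_1,...,u_q,v) is an almost complete intersection, in the sense that
   includes (u_1,...,u_q) being a complete intersection. *)
Definition almost_complete_intersection (I : idealr {mpoly K[n]}) (q : nat)
    (u : q.-tuple 'X_{1..n}) (v : 'X_{1..n}) : Prop :=
  [/\ minimal_generators I (rcons u v), height I q
    & exists2 J : idealr {mpoly K[n]},
        generated_by u J & complete_intersection J].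

Definition dominant (I : idealr {mpoly K[n]}) : Prop :=
  exists2 G, minimal_generators I G &
    forall m, m \in G ->
      exists k : 'I_n, forall m', m' \in G -> m' != m -> (m' k < m k)%N.

End MonomialIdeals.

(* Main.v *)
Require Import Defs.
From HB Require Import structures.
From mathcomp Require Import all_boot all_order all_algebra.
From mathcomp.multinomials Require Import mpoly.
From mathcomp Require Import boolp ring zify.

(* Since the u_i are pairwise coprime and none divides v, I is dominant iff v
   does not divide u_1 ... u_q.

   If v divides the product, splitting off variables filters R/I by quotients
   R/(x_{t 1}, ..., x_{t q}) with x_{t i} dividing u_i. By Zariski's lemma each
   variable is a root of a monic F_k modulo a given maximal ideal M; the n - q
   elements F_k(x_k), or F_k(x_k) - F_b(x_b) with b a base point of the support
   of u_i containing k, lie in M and are regular on each of these quotients,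
   hence on R/I. Chains of primes and regular sequences of R/I both yield
   elements that are algebraically independent over K, so counting the monomials
   outside I bounds their length by n - q; conversely the contractions of M to
   subrings generated by variables give a chain of that length.

   If I is dominant, the top syzygy of the Taylor resolution gives a nonzero
   Koszul homology class of degree q + 1 with coefficients in R/I. Every element
   of a regular sequence in the irrelevant ideal raises the degree of such a
   class by one, so the depth there is at most n - q - 1, while the height is at
   least n - q. *)

Set Implicit Arguments.
Unset Strict Implicit.
Unset Printing Implicit Defensive.

Import GRing.Theory.
Local Open Scope ring_scope.

(** * Weakly regular sequences *)

Section IdealPredicates.
Variable R : comNzRingType.
Implicit Types (I J : R -> Prop) (s : seq R).

(** Cohen-Macaulayness is tested at every maximal ideal M, and K need not be algebraically closed,
    so M cannot be translated to the origin: the F_k take the place of the x_k - a_k. A single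
    sequence must be regular on all the quotients R/(x_{t 1}, ..., x_{t q}) met by the filtration.
    There F_k(x_k) alone fails, becoming a constant, possibly zero, if x_k is one of the x_{t i};
    the subtracted F_b(x_b) then remains, monic in x_b. The order in which the parameters are seen
    to be regular depends on t, and regular sequences of a nonlocal ring may not be permuted, hence
    a permutation-invariant notion. Divisibility also controls the height: it puts a variable of v
    lying in M into the support of some u_i, so that q variables in M generate an ideal containing
    I. In the converse direction one bad maximal ideal is enough. *)

Definition is_ideal I : Prop :=
  [/\ I 0, forall a b, I a -> I b -> I (a + b) & forall a b, I b -> I (a * b)].

Lemma ideal0 I : is_ideal I -> I 0. Proof. by case. Qed.
Lemma idealD I a b : is_ideal I -> I a -> I b -> I (a + b).
Proof. by case=> _ + _; apply. Qed.
Lemma idealM I a b : is_ideal I -> I b -> I (a * b).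
Proof. by case=> _ _; apply. Qed.
Lemma idealN I a : is_ideal I -> I a -> I (- a).
Proof. by move=> idI Ia; rewrite -mulN1r; apply: idealM. Qed.
Lemma idealB I a b : is_ideal I -> I a -> I b -> I (a - b).
Proof. by move=> idI Ia Ib; apply: idealD => //; apply: idealN. Qed.
Lemma ideal_sum I (T : Type) (r : seq T) (P : pred T) (F : T -> R) :
  is_ideal I -> (forall i, P i -> I (F i)) -> I (\sum_(i <- r | P i) F i).
Proof.
move=> idI IF; elim/big_ind: _ => //; first exact: ideal0.
by move=> x y; apply: idealD.
Qed.

Lemma pred_ext I J : (forall p, I p <-> J p) -> I = J.
Proof. by move=> IJ; apply/funext => p; apply/propext. Qed.

Definition addI I y : R -> Prop := fun p => exists c, I (p - c * y).
Definition colon I m : R -> Prop := fun p => I (m * p).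
Definition reg I y : Prop := forall a, I (y * a) -> I a.

Lemma is_ideal_zero : is_ideal (fun p : R => p = 0).
Proof. by split=> // [a b -> ->|a b ->]; rewrite ?addr0 ?mulr0. Qed.

Lemma is_ideal_addI I y : is_ideal I -> is_ideal (addI I y).
Proof.
move=> idI; split.
- by exists 0; rewrite mul0r subr0; apply: ideal0.
- move=> a b [c Ia] [d Ib]; exists (c + d).
  by rewrite (_ : _ - _ = (a - c * y) + (b - d * y)); [apply: idealD | ring].
- move=> a b [c Ib]; exists (a * c).
  by rewrite (_ : _ - _ = a * (b - c * y)); [apply: idealM | ring].
Qed.

Lemma addI_sub I y p : I p -> addI I y p.
Proof. by exists 0; rewrite mul0r subr0. Qed.

Lemma addI_gen I y : is_ideal I -> addI I y y.
Proof. by move=> idI; exists 1; rewrite mul1r subrr; apply: ideal0. Qed.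

Lemma addIC I x y : addI (addI I x) y = addI (addI I y) x.
Proof.
apply: pred_ext => p.
by split=> -[c [d Ip]]; exists d, c; rewrite addrAC.
Qed.

Fixpoint adds I s := if s is y :: s' then adds (addI I y) s' else I.

(** Properness is left out, and ideals are plain predicates that may contain 1: the filtration runs
    into the unit ideal, modulo which every sequence is weakly regular. *)
Fixpoint wreg I s : Prop :=
  if s is y :: s' then reg I y /\ wreg (addI I y) s' else True.

(* Every subsequence of s is weakly regular modulo I: this notion, unlike
   weak regularity, is invariant under permutations. *)
Fixpoint sreg I s : Prop :=
  if s is y :: s' then [/\ reg I y, sreg I s' & sreg (addI I y) s'] else True.

Lemma adds_cons I y s p : adds I (y :: s) p <-> exists c, adds I s (p - c * y).
Proof. by elim: s I p => [|z s IHs] I p //=; rewrite addIC; apply: IHs. Qed.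

Lemma is_ideal_adds I s : is_ideal I -> is_ideal (adds I s).
Proof. by elim: s I => //= y s IHs I idI; apply/IHs/is_ideal_addI. Qed.

Lemma adds_sub I s p : I p -> adds I s p.
Proof. by elim: s I => //= y s IHs I Ip; apply/IHs/addI_sub. Qed.

Lemma adds_gen I s x : is_ideal I -> x \in s -> adds I s x.
Proof.
elim: s I => //= y s IHs I idI; rewrite inE => /orP[/eqP->|].
  by apply/adds_sub/addI_gen.
by apply: IHs; apply: is_ideal_addI.
Qed.

Lemma adds_min I J s : is_ideal J -> (forall p, I p -> J p) ->
  (forall y, y \in s -> J y) -> forall p, adds I s p -> J p.
Proof.
move=> idJ; elim: s I => //= y s IHs I IJ sJ.
apply: IHs => [p [c Ip]|z zs]; last by apply: sJ; rewrite inE zs orbT.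
rewrite -(subrK (c * y) p); apply: idealD => //; first exact: IJ.
by apply: idealM => //; apply: sJ; rewrite mem_head.
Qed.

(** If m p = c y modulo I, then y annihilates c modulo I + (m), so c = e m modulo I and m (p - e y)
    lies in I. *)
Lemma colon_reg_addI I m y : is_ideal I -> reg (addI I m) y ->
  colon (addI I y) m = addI (colon I m) y.
Proof.
move=> idI reg_y; apply: pred_ext => p; split=> -[c].
  move=> Imp; have [|e Ie] := reg_y c.
    exists p; rewrite (_ : _ - _ = - (m * p - c * y)); last by ring.
    exact: idealN.
  exists e; rewrite /colon.
  rewrite (_ : m * _ = (m * p - c * y) + y * (c - e * m)); last by ring.
  by apply: idealD => //; apply: idealM.
rewrite /colon => Ip; exists (m * c).
by rewrite (_ : _ - _ = m * (p - c * y)) //; ring.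
Qed.

(* 0 -> R/(I : m) -> R/I -> R/(I + m) -> 0 is exact, and stays so modulo a
   sequence that is weakly regular on the quotient. *)
Lemma wreg_ext I m s : is_ideal I ->
  wreg (colon I m) s -> wreg (addI I m) s -> wreg I s.
Proof.
elim: s I => //= y s IHs I idI [reg1 wreg1] [reg2 wreg2]; split.
  move=> a Iya; have [c Ia] := reg2 a (addI_sub _ Iya).
  rewrite -(subrK (c * m) a); apply: idealD => //; rewrite mulrC; apply: reg1.
  rewrite /colon (_ : m * _ = y * a - y * (a - c * m)); last by ring.
  by apply: idealB => //; apply: idealM.
apply: IHs; first exact: is_ideal_addI.
  by rewrite colon_reg_addI.
by rewrite addIC.
Qed.

Lemma wreg1 I s : is_ideal I -> I 1 -> wreg I s.
Proof.
elim: s I => //= y s IHs I idI I1; split.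
  by move=> a _; rewrite -[a]mulr1; apply: idealM.
by apply: IHs; [apply: is_ideal_addI | apply: addI_sub].
Qed.

Lemma sreg_wreg I s : sreg I s -> wreg I s.
Proof. by elim: s I => //= y s IHs I [? _ ?]; split; auto. Qed.

(** Only the regularity of x modulo I + (y) is new: x a = c y modulo I gives c = d x by regularity
    of y modulo I + (x), then a = d y by regularity of x. *)
Lemma sreg_swap I x y s : is_ideal I ->
  sreg I (x :: y :: s) -> sreg I (y :: x :: s).
Proof.
move=> idI /= [reg_x [reg_y sI sIy] [reg_xy sIx sIxy]].
split=> //; split=> //; last by rewrite addIC.
move=> a [c Ixa]; have [|d Ic] := reg_xy c.
  exists a; rewrite (_ : _ - _ = - (x * a - c * y)); last by ring.
  exact: idealN.
exists d; apply: reg_x.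
rewrite (_ : _ * _ = (x * a - c * y) + y * (c - d * x)); last by ring.
by apply: idealD => //; apply: idealM.
Qed.

Lemma sreg_cons_congr x s t : 
  (forall I, is_ideal I -> sreg I s -> sreg I t) ->
  forall I, is_ideal I -> sreg I (x :: s) -> sreg I (x :: t).
Proof.
move=> st I idI /= [? ? ?].
by split; [|apply: st|apply: st => //; apply: is_ideal_addI].
Qed.

Lemma sreg_perm s t : perm_eq s t ->
  forall I, is_ideal I -> sreg I s -> sreg I t.
Proof.
move=> st I idI; move: st.
have mid x (s1 s2 : seq R) J : is_ideal J ->
    sreg J (s1 ++ x :: s2) -> sreg J (x :: s1 ++ s2).
  elim: s1 J => // y s1 IHs1 J idJ sJ; apply: sreg_swap => //.
  apply: sreg_cons_congr idJ sJ => I' idI'; exact: IHs1.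
have catCA (s1 s2 s3 : seq R) J : is_ideal J ->
    sreg J (s1 ++ s2 ++ s3) -> sreg J (s2 ++ s1 ++ s3).
  elim: s2 J => // x s2 IHs2 J idJ.
  rewrite -[_ ++ _]/(s1 ++ x :: (s2 ++ s3)) => /(mid _ _ _ _ idJ).
  rewrite cat_cons; apply: sreg_cons_congr idJ => I' idI'; exact: IHs2.
by move=> st; apply: (catCA_perm_ind _ st) => s1 s2 s3; apply: catCA.
Qed.

Lemma sreg_cat I s t : sreg I (s ++ t) -> sreg (adds I s) t.
Proof. by elim: s I => //= x s IHs I [_ _]; apply: IHs. Qed.

End IdealPredicates.

(** * Koszul homology *)

Section Koszul.
Variables (R : comNzRingType) (n : nat) (g : 'I_n -> R).
Implicit Types (z t : {set 'I_n} -> R) (S : {set 'I_n}).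

Definition ksgn (j : 'I_n) S : R := (-1) ^+ #|[set i in S | (i < j)%N]|.

(** The Koszul differential, contraction with g, in coordinates; [kwedge] is left multiplication by
    the form with coefficients c. The sign [ksgn j S] is that of sorting j into S. *)
Definition kbd z S : R := \sum_(j | j \notin S) ksgn j S * g j * z (j |: S).

Definition kwedge (c : 'I_n -> R) z S : R :=
  \sum_(j in S) ksgn j (S :\ j) * c j * z (S :\ j).

Lemma ksgnU1 i j S : i \notin S -> ksgn j (i |: S) = (-1) ^+ (i < j)%N * ksgn j S.
Proof.
move=> iS; rewrite /ksgn; case: (ltnP i j) => ij /=.
  rewrite (_ : [set _ in _ | _] = i |: [set k in S | (k < j)%N]).
    by rewrite cardsU1 inE (negPf iS) exprD.
  by apply/setP=> k; rewrite !inE; case: (eqVneq k i) => // ->; rewrite ij.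
rewrite mul1r; congr (_ ^+ #|pred_of_set _|).
apply/setP=> k; rewrite !inE; case: (eqVneq k i) => //= ->.
by rewrite ltnNge ij andbF.
Qed.

Lemma ksgn_sq j S : ksgn j S * ksgn j S = 1.
Proof. by rewrite /ksgn -signr_odd -expr2 sqrr_sign. Qed.

Lemma ksgn_anti i j : i != j :> 'I_n ->
  (-1) ^+ (i < j)%N = - (-1) ^+ (j < i)%N :> R.
Proof.
by rewrite -val_eqE; case: ltngtP => //= _ _; rewrite expr1 expr0 ?opprK.
Qed.

Lemma kbd_bd z S : kbd (kbd z) S = 0.
Proof.
pose F j i := ksgn j S * g j * (ksgn i (j |: S) * g i * z (i |: (j |: S))).
have Fanti i j : i \notin S -> j \notin S -> i != j -> F i j = - F j i.
  move=> iS jS ij; rewrite /F !ksgnU1 // setUCA (ksgn_anti ij); ring.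
transitivity (\sum_(j | j \notin S) \sum_(i | i \notin j |: S) F j i).
  by apply: eq_bigr => j _; rewrite /kbd mulr_sumr.
(* Antisymmetry of F alone would only show that twice the sum vanishes, so the pairs with i < j are
   cancelled against those with j < i. *)
rewrite (eq_bigr (fun j : 'I_n => \sum_(i | (i \notin S) && (i < j)%N) F j i
   + \sum_(i | (i \notin S) && (j < i)%N) F j i)); last first.
  move=> j jS; rewrite (bigID (fun i : 'I_n => (i < j)%N)) /=; congr (_ + _).
    apply: eq_bigl => i; rewrite in_setU1 negb_or.
    by case: (eqVneq i j) => [->|//]; rewrite ltnn !andbF.
  apply: eq_bigl => i; rewrite in_setU1 negb_or -leqNgt leq_eqVlt eq_sym val_eqE.
  by case: (eqVneq i j) => [->|//]; rewrite ltnn !andbF.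
rewrite big_split /= addrC.
rewrite (exchange_big_dep (fun i => i \notin S)) /=; last by move=> ? ? _ /andP[].
rewrite -big_split big1 //= => i iS.
rewrite -[X in _ + X]opprK; apply/eqP; rewrite subr_eq0; apply/eqP.
rewrite -sumrN; apply: eq_big => [j|j /andP[jS /andP[_ ji]]].
  by rewrite iS.
by apply: Fanti => //; apply: contraTneq ji => ->; rewrite ltnn.
Qed.

(* The homotopy showing that the elements of
   the ideal generated by g act as zero on the Koszul homology. *)
Lemma kbd_wedge c z S :
  kbd (kwedge c z) S + kwedge c (kbd z) S = (\sum_j c j * g j) * z S.
Proof.
pose F j i := ksgn j (S :\ i) * ksgn i (S :\ i) * g j * c i * z (j |: S :\ i).
have bdE : kbd (kwedge c z) S = (\sum_(j | j \notin S) c j * g j) * z S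
    - \sum_(i in S) \sum_(j | j \notin S) F j i.
  rewrite exchange_big mulr_suml -sumrB /=; apply: eq_bigr => j jS.
  rewrite /kwedge big_setU1 //= setU1K // mulrDr.
  rewrite (_ : _ * (_ * _) = c j * g j * z S); last first.
    rewrite -[RHS]mul1r -[X in _ = X * _](ksgn_sq j S); ring.
  congr (_ + _); rewrite -sumrN mulr_sumr; apply: eq_bigr => i iS.
  have ji : j != i by apply: contraNneq jS => ->.
  have -> : (j |: S) :\ i = j |: S :\ i.
    apply/setP=> k; rewrite !inE; case: (eqVneq k j) => //= ->.
    by rewrite ji.
  rewrite -{1}(setD1K iS) !ksgnU1 ?inE ?eqxx //; last by rewrite negb_and jS orbT.
  rewrite (ksgn_anti ji) /F.
  rewrite -[RHS]mul1r -[X in _ = X * _](sqrr_sign R (i < j)%N); ring.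
have weE : kwedge c (kbd z) S = (\sum_(j in S) c j * g j) * z S
    + \sum_(i in S) \sum_(j | j \notin S) F j i.
  rewrite mulr_suml -big_split /=; apply: eq_bigr => i iS.
  rewrite /kbd (bigD1 i) ?inE ?eqxx //= setD1K // mulrDr.
  rewrite (_ : _ * (_ * _) = c i * g i * z S); last first.
    rewrite -[RHS]mul1r -[X in _ = X * _](ksgn_sq i (S :\ i)); ring.
  congr (_ + _); rewrite mulr_sumr; apply: eq_big => [j|j _].
    by rewrite !inE; case: (eqVneq j i) => [->|] //=; rewrite ?iS ?andbT.
  rewrite /F; ring.
rewrite bdE weE addrACA addNr addr0 -mulrDl; congr (_ * _).
rewrite [RHS](bigID (fun j => j \in S)) /= addrC; congr (_ + _).
Qed.

Lemma kbdD z t S : kbd (fun S => z S + t S) S = kbd z S + kbd t S.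
Proof. by rewrite -big_split; apply: eq_bigr => j _; rewrite mulrDr. Qed.

Lemma kbdZ a z S : kbd (fun S => a * z S) S = a * kbd z S.
Proof. by rewrite mulr_sumr; apply: eq_bigr => j _; rewrite mulrCA. Qed.

Lemma kbd_ideal (I : R -> Prop) z : is_ideal I ->
  (forall S, I (z S)) -> forall S, I (kbd z S).
Proof.
by move=> idI Iz S; apply: ideal_sum => // j _; apply: idealM.
Qed.

Lemma kwedge_ideal (I : R -> Prop) c z : is_ideal I ->
  (forall S, I (z S)) -> forall S, I (kwedge c z S).
Proof.
by move=> idI Iz S; apply: ideal_sum => // j _; apply: idealM.
Qed.

(* H_k(g; R/I) is nonzero. An element of the Koszul complex is encoded by its
   coordinates, indexed by the subsets of 'I_n of all sizes at once. *)
Definition koszul_nonzero (I : R -> Prop) (k : nat) : Prop :=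
  exists z, [/\ forall S, #|S| != k -> z S = 0, forall S, I (kbd z S)
    & forall t, ~ forall S, I (z S - kbd t S)].

(* The connecting map of 0 -> R/I -> R/I -> R/(I + y) -> 0, where
   y = sum_j c_j g_j, sends the class of the wedge of c and z to that of z. *)
Lemma koszul_nonzero_addI I k c : is_ideal I ->
  reg I (\sum_j c j * g j) -> koszul_nonzero I k ->
  koszul_nonzero (addI I (\sum_j c j * g j)) k.+1.
Proof.
set y := \sum_j _ => idI reg_y [z [z_k z_cyc z_bd]].
have bdw S : kbd (kwedge c z) S = y * z S - kwedge c (kbd z) S.
  by rewrite -kbd_wedge addrK.
exists (kwedge c z); split.
- move=> S Sk; rewrite /kwedge big1 // => j jS; rewrite z_k ?mulr0 //.
  by apply: contraNneq Sk => <-; rewrite (cardsD1 j S) jS.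
- move=> S; rewrite bdw; exists (z S).
  rewrite (_ : _ - _ = - kwedge c (kbd z) S); last by ring.
  by apply: idealN => //; apply: kwedge_ideal.
(* If the wedge of c and z equals kbd t + s y modulo I, applying [kbd] gives y z = y kbd s modulo I,
   and cancelling y makes z a boundary. *)
move=> t /boolp.choice[s] Iwts; apply: (z_bd s) => S; apply: reg_y.
have := kbd_ideal idI Iwts S.
have -> : kbd (fun S => kwedge c z S - kbd t S - s S * y) S
   = kbd (kwedge c z) S - kbd (kbd t) S - y * kbd s S.
  rewrite -[X in _ - X - _]mul1r -!mulNr -!kbdZ -!kbdD; apply: eq_bigr => j _.
  congr (_ * _); ring.
rewrite kbd_bd bdw => Ids.
rewrite (_ : _ * _ = (y * z S - kwedge c (kbd z) S - 0 - y * kbd s S)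
    + kwedge c (kbd z) S); last by ring.
by apply: idealD => //; apply: kwedge_ideal.
Qed.

Lemma koszul_bound I k s : is_ideal I ->
  (forall y, y \in s -> exists c, y = \sum_j c j * g j) ->
  wreg I s -> koszul_nonzero I k -> (k + size s <= n)%N.
Proof.
elim: s I k => [|y s IHs] I k idI s_g.
  move=> _ [z [z_k _ z_bd]]; rewrite addn0 leqNgt; apply/negP=> nk.
  apply: (z_bd (fun=> 0)) => S; rewrite z_k; last first.
    by rewrite neq_ltn (leq_ltn_trans (max_card _)) // card_ord.
  by rewrite /kbd big1 ?subr0 => [|j _]; rewrite ?mulr0 //; apply: ideal0.
have [c def_y] := s_g y (mem_head _ _).
rewrite /= => -[reg_y wreg_s] nz; rewrite addnS -addSn.
apply: IHs (wreg_s) _; first exact: is_ideal_addI.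
  by move=> z zs; apply: s_g; rewrite inE zs orbT.
by rewrite def_y in reg_y *; apply: koszul_nonzero_addI.
Qed.

End Koszul.

(** * Growth and algebraic independence *)

Section Growth.
Variables (K : fieldType) (n : nat).
Local Notation R := {mpoly K[n]}.
Implicit Types (I J : R -> Prop) (s : seq R).

(* A common generalization of chains of primes (y in the next prime but not in
   the current one) and of regular sequences (J is I + (y)): in both cases the
   y's are algebraically independent modulo I. *)
Fixpoint tower I s : Prop :=
  if s is y :: s' then
    reg I y /\ exists J, [/\ is_ideal J, forall p, I p -> J p, J y & tower J s']
  else ~ I 1.

Lemma wreg_tower I s : is_ideal I -> wreg I s -> ~ adds I s 1 -> tower I s.
Proof.
elim: s I => //= y s IHs I idI [reg_y wreg_s] s1; split=> //.
exists (addI I y); split; first exact: is_ideal_addI.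
- exact: addI_sub.
- exact: addI_gen.
- by apply: IHs => //; apply: is_ideal_addI.
Qed.

Fixpoint box (N r : nat) : seq (seq nat) :=
  if r is r'.+1 then [seq a :: e | a <- iota 0 N, e <- box N r'] else [:: [::]].

Fixpoint powp s (e : seq nat) : R :=
  match s, e with y :: s', a :: e' => y ^+ a * powp s' e' | _, _ => 1 end.

Lemma size_box N r : size (box N r) = (N ^ r)%N.
Proof. by elim: r => //= r IHr; rewrite size_allpairs size_iota IHr expnS. Qed.

Lemma box_uniq N r : uniq (box N r).
Proof.
elim: r => //= r IHr; apply: allpairs_uniq; rewrite ?iota_uniq //.
by move=> [a e] [b f] _ _ /= [-> ->].
Qed.

(* In a relation between monomials in y :: s, the lowest power of y has a
   coefficient that lies in J: induct on s. *)
Lemma tower_free I s N (c : seq nat -> K) : is_ideal I -> tower I s ->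
  I (\sum_(e <- box N (size s)) c e *: powp s e) ->
  forall e, e \in box N (size s) -> c e = 0.
Proof.
elim: s I c => [|y s IHs] I c idI /=.
  move=> I1; rewrite big_seq1 => Ic e; rewrite inE => /eqP->.
  apply/eqP; apply: contra_notT I1 => c0.
  rewrite -(scale1r 1) -(mulVf c0) -scalerA -mul_mpolyC; exact: idealM.
move=> [reg_y [J [idJ IJ Jy tow]]].
rewrite big_allpairs_dep /= => Isum e /allpairsP[[a f] /= []].
rewrite mem_iota add0n => aN fB ->; move: c a aN f fB Isum.
set B := box N (size s).
pose T (c : seq nat -> K) a := \sum_(f <- B) c (a :: f) *: powp s f.
have ->: iota 0 N = index_iota 0 N by rewrite /index_iota subn0.
have {}IHs c : J (\sum_(f <- B) c f *: powp s f) -> forall f, f \in B -> c f = 0.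
  exact: IHs.
have TE c k (F : nat -> nat) : \sum_(0 <= a < k) \sum_(f <- B)
      c (F a :: f) *: (y ^+ a * powp s f) = \sum_(0 <= a < k) y ^+ a * T c (F a).
  apply: eq_bigr => a _; rewrite mulr_sumr; apply: eq_bigr => f _.
  by rewrite scalerAr.
(* [F] shifts the exponents: once the lowest coefficients vanish and a factor y is cancelled, the
   remaining sum has the same form. *)
suff step k c (F : nat -> nat) : I (\sum_(0 <= a < k) y ^+ a * T c (F a)) ->
    forall a, (a < k)%N -> forall f, f \in B -> c (F a :: f) = 0.
  move=> c a aN f fB Isum; apply: (step _ c id _ a aN f fB).
  by rewrite -(TE c _ id).
elim: k F => // k IHk F.
rewrite big_nat_recl // expr0 mul1r.
have -> : \sum_(0 <= i < k) y ^+ i.+1 * T c (F i.+1)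
    = y * \sum_(0 <= i < k) y ^+ i * T c (F i.+1).
  by rewrite mulr_sumr; apply: eq_bigr => i _; rewrite exprS mulrA.
set U := \sum_(0 <= i < k) _ => Isum.
have c0 f : f \in B -> c (F 0%N :: f) = 0.
  apply: (IHs (fun f => c (F 0%N :: f))); rewrite -/(T c (F 0%N)).
  rewrite -(addrK (y * U) (T _ _)); apply: idealB => //; first exact: IJ.
  by rewrite mulrC; apply: idealM.
move=> [|a] ak f fB; first exact: c0.
apply: (IHk (fun a => F a.+1)) => //; apply: reg_y.
suff T0 : T c (F 0%N) = 0 by rewrite T0 add0r in Isum.
by rewrite /T big1_seq // => f' /andP[_ /c0->]; rewrite scale0r.
Qed.

Lemma mdeg_msuppM (p q : R) d e :
  (forall m, m \in msupp p -> mdeg m <= d)%N ->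
  (forall m, m \in msupp q -> mdeg m <= e)%N ->
  forall m, m \in msupp (p * q) -> (mdeg m <= d + e)%N.
Proof.
move=> pd qe m /msuppM_le /allpairsP[[m1 m2] /= [m1p m2q ->]].
by rewrite mdegD leq_add ?pd ?qe.
Qed.

Lemma mdeg_powp s e d N m :
  (forall y, y \in s -> forall m, m \in msupp y -> mdeg m <= d)%N ->
  e \in box N (size s) -> m \in msupp (powp s e) ->
  (mdeg m <= size s * (N * d))%N.
Proof.
elim: s e m => [|y s IHs] e m s_d /=.
  by move=> _; rewrite msupp1 inE => /eqP->; rewrite mdeg0.
move=> /allpairsP[[b f] /= []]; rewrite mem_iota add0n => /andP[_ bN] fB -> /=.
rewrite mulSn; apply: mdeg_msuppM m => m; last first.
  by apply: IHs => // z zs; apply: s_d; rewrite inE zs orbT.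
move=> mP; apply: (@leq_trans (b * d)); last by rewrite leq_mul2r ltnW ?orbT.
elim: b m mP {bN} => [|b IHb] m.
  by rewrite expr0 msupp1 inE => /eqP->; rewrite mdeg0.
by rewrite exprS mulSn; apply: mdeg_msuppM m => //; apply: s_d; apply: mem_head.
Qed.

(** A union bound over T, with at most 2 ^ n choices; what matters is that for fixed D the count has
    degree n - q in E. *)
Lemma card_bounded (q D E : nat) :
  (#|[set f : {ffun 'I_n -> 'I_E.+1} | [exists T : {set 'I_n},
     (#|T| == q) && [forall t in T, (f t < D)%N]]]|
   <= 2 ^ n * (D ^ q * E.+1 ^ (n - q)))%N.
Proof.
pose F (T : {set 'I_n}) (x : 'I_n) : pred 'I_E.+1 :=
  if x \in T then [pred i : 'I_E.+1 | (i < D)%N] else predT.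
apply: leq_trans (_ : #|\bigcup_(T : {set 'I_n} | #|T| == q)
    [set f : {ffun 'I_n -> 'I_E.+1} | f \in family (F T)]| <= _)%N.
  apply/subset_leq_card/subsetP => f; rewrite inE => /existsP[T /andP[Tq fT]].
  apply/bigcupP; exists T => //; rewrite inE; apply/familyP => x; rewrite /F.
  by case: ifP => // xT; move/forall_inP: fT; apply.
apply: leq_trans (_ : \sum_(T : {set 'I_n} | #|T| == q) D ^ q * E.+1 ^ (n - q) <= _)%N.
  apply: (@leq_trans (\sum_(T : {set 'I_n} | #|T| == q)
      #|[set f : {ffun 'I_n -> 'I_E.+1} | f \in family (F T)]|)).
    elim/big_rec2: _ => [|T m A _ Am]; first by rewrite cards0.
    by apply: leq_trans (leq_card_setU _ _) _; rewrite leq_add2l.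
  apply: leq_sum => T /eqP Tq; rewrite cardsE card_family foldrE big_map.
  rewrite big_enum /= (bigID (mem T)) /= leq_mul //.
    rewrite -Tq -prod_nat_const; apply: leq_prod => i iT; rewrite /F iT.
    case: (leqP D E.+1) => DE; last first.
      by rewrite (leq_trans (max_card _)) // card_ord ltnW.
    have inj : injective (widen_ord DE) by move=> a b /(congr1 val) /= /val_inj.
    rewrite -[X in (_ <= X)%N](card_ord D) -(card_image inj).
    apply: subset_leq_card; apply/subsetP => j; rewrite inE => jD.
    by apply/imageP; exists (Ordinal jD) => //; apply: val_inj.
  have -> : (n - q)%N = #|~: T| by rewrite cardsCs setCK card_ord Tq.
  rewrite -prod_nat_const; under [X in (_ <= X)%N]eq_bigl do rewrite inE.
  apply: leq_prod => i iT; rewrite (leq_trans (max_card _)) ?card_ord //.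
rewrite sum_nat_const leq_mul2r (_ : (2 ^ n)%N = #|powerset [set: 'I_n]|).
  by rewrite subset_leq_card ?orbT //; apply/subsetP => T; rewrite powersetE subsetT.
by rewrite card_powerset cardsT card_ord.
Qed.

(** If s has r > n - q elements, its N ^ r power products have degrees linear in N, while only O(N ^
    (n - q)) monomials of such degrees lie outside I. For large N this forces a linear relation
    modulo I, against [tower_free]. *)
Lemma tower_size I s q D : is_ideal I ->
  (forall m, ~ I 'X_[m] -> exists2 T : {set 'I_n}, #|T| = q
     & forall t, t \in T -> (m t < D)%N) ->
  tower I s -> (size s <= n - q)%N.
Proof.
move=> idI std tow; rewrite leqNgt; apply/negP => lt_s.
have [d s_d] : exists d, forall y, y \in s ->
    forall m, m \in msupp y -> (mdeg m <= d)%N.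
  exists (\max_(y <- s) \max_(m <- msupp y) mdeg m) => y ys m mP.
  apply: leq_trans (leq_bigmax_seq y ys isT).
  exact: leq_bigmax_seq.
set r := size s in lt_s.
(* As E.+1 is at most (r d + 1) N, at most C N ^ (n - q) monomials count, fewer than N ^ (n - q +
   1). Taking C + 2 also keeps N above 1. *)
pose C := (2 ^ n * (D ^ q * (r * d).+1 ^ (n - q)))%N.
pose N := C.+2; pose E := (r * (N * d))%N.
pose S := [set f : {ffun 'I_n -> 'I_E.+1} | [exists T : {set 'I_n},
     (#|T| == q) && [forall t in T, (f t < D)%N]]].
pose mon (f : {ffun 'I_n -> 'I_E.+1}) : 'X_{1..n} := [multinom f i : nat | i < n].
have cardS : (#|S| < size (box N r))%N.
  rewrite size_box (leq_ltn_trans (card_bounded _ _ _)) //.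
  apply: (@leq_trans (N ^ (n - q).+1)); last by rewrite leq_exp2l.
  apply: (@leq_ltn_trans (C * N ^ (n - q))); last first.
    by rewrite expnS ltn_pmul2r ?expn_gt0 //; apply: leqnSn.
  rewrite /C -!mulnA; do 2 (rewrite leq_mul2l; apply/orP; right).
  rewrite -expnMn; case: (n - q)%N => // e; rewrite leq_exp2r //.
  by rewrite /E; nia.
pose A : 'M[K]_(size (box N r), #|S|) :=
  \matrix_(i, j) (powp s (nth [::] (box N r) i))@_(mon (enum_val j)).
have [w wA w0] : exists2 w : 'rV_(size (box N r)), w *m A = 0 & w != 0.
  have : kermx A != 0.
    by rewrite kermx_eq0 neq_ltn (leq_ltn_trans (rank_leq_col A)).
  by move/rowV0Pn => [w /sub_kermxP wA w0]; exists w.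
pose c e := oapp (w 0) 0 (insub (index e (box N r))).
have cE (i : 'I_(size (box N r))) : c (nth [::] (box N r) i) = w 0 i.
  by rewrite /c index_uniq ?box_uniq // valK.
suff Isum : I (\sum_(e <- box N r) c e *: powp s e).
  case/negP: w0; apply/eqP/rowP => i; rewrite mxE -cE.
  by apply: (tower_free idI tow Isum); apply: mem_nth.
set p := \sum_(e <- _) _.
have p_deg m : m \in msupp p -> (mdeg m <= E)%N.
  move/msupp_sum_le => /flattenP[_ /mapP[e eB ->]] /msuppZ_le.
  by apply: mdeg_powp; move: eB; rewrite mem_filter.
rewrite [p]mpolyE big_seq; apply: ideal_sum => // m mp.
have [Im | /std[T Tq mT]] := pselect (I 'X_[m]).
  by rewrite -mul_mpolyC; apply: idealM.
have mE i : (m i < E.+1)%N.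
  by rewrite ltnS (leq_trans _ (p_deg m mp)) // mdegE (bigD1 i) //= leq_addr.
pose f := [ffun i => Ordinal (mE i)].
have fS : f \in S.
  rewrite inE; apply/existsP; exists T; rewrite Tq eqxx.
  by apply/forall_inP => t tT; rewrite ffunE mT.
have fm : mon f = m by apply/mnmP => i; rewrite mnmE ffunE.
have := congr1 (fun M : 'rV_#|S| => M 0 (enum_rank_in fS f)) wA.
rewrite !mxE => wA0; suff -> : p@_m = 0 by rewrite scale0r; apply: ideal0.
rewrite -{}wA0 /p raddf_sum (big_nth [::]) big_mkord; apply: eq_bigr => i _.
by rewrite -(cE i) mxE enum_rankK_in // fm -mcoeffZ.
Qed.

End Growth.

(** * Sequences of polynomials monic in separate variables *)

Section Univariate.
Variables (K : fieldType) (n : nat).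
Local Notation R := {mpoly K[n]}.
Implicit Types (I J : R -> Prop) (s : seq R) (p g : R).

Lemma mpoly_rmorph_eq (S : comNzRingType) (f h : {rmorphism R -> S}) :
  (forall c, f c%:MP = h c%:MP) -> (forall i, f 'X_i = h 'X_i) -> f =1 h.
Proof.
move=> fhC fhX p; rewrite [p]mpolyE !rmorph_sum; apply: eq_bigr => m _.
rewrite -mul_mpolyC !rmorphM fhC mpolyXE_id !rmorph_prod; congr (_ * _).
by apply: eq_bigr => i _; rewrite !rmorphXn fhX.
Qed.

(** The coefficients stay in R, so the other variables need no reindexing and evaluation at x_k
    recovers the polynomial. *)
Definition uni (k : 'I_n) : R -> {poly R} :=
  mmap (polyC \o @mpolyC n K) (fun i => if i == k then 'X else ('X_i)%:P).

HB.instance Definition _ k := GRing.RMorphism.on (uni k).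

Lemma uniC k c : uni k c%:MP = c%:MP%:P. Proof. exact: mmapC. Qed.
Lemma uniX k i : uni k 'X_i = if i == k then 'X else ('X_i)%:P.
Proof. by rewrite /uni mmapX mmap1U. Qed.

Lemma uniB k p g : uni k (p - g) = uni k p - uni k g.
Proof. exact: rmorphB. Qed.
Lemma uniM k p g : uni k (p * g) = uni k p * uni k g.
Proof. exact: rmorphM. Qed.

Lemma uni_horner k p : (uni k p).['X_k] = p.
Proof.
pose f : R -> R := horner_eval 'X_k \o uni k.
apply: (@mpoly_rmorph_eq R f idfun) => [c|i] /=; rewrite /horner_eval.
  by rewrite uniC hornerC.
by rewrite uniX; case: eqP => [->|_]; rewrite ?hornerX ?hornerC.
Qed.

Definition lacks (k : 'I_n) p := uni k p == p%:P.

(* Monic in x_k up to a nonzero scalar. *)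
Definition monic_in (k : 'I_n) p : Prop :=
  exists2 c : K, c != 0 & lead_coef (uni k p) = c%:MP.

(** For an ideal this says that I is generated by polynomials in which x_k does not occur. *)
Definition free_of (k : 'I_n) I : Prop :=
  forall p, I p -> forall e, I (uni k p)`_e.

(** Descending induction on e: modulo I the coefficient of G P in degree deg G + e reduces to c P_e,
    since the other terms involve coefficients of P above e or vanish. *)
Lemma coef_monicM I (G P : {poly R}) c : is_ideal I -> c != 0 ->
  lead_coef G = c%:MP -> (forall e, I (G * P)`_e) -> forall e, I P`_e.
Proof.
move=> idI c0 lG IGP e.
suff PI m e' : (size P <= e' + m)%N -> I P`_e' by apply: (PI (size P)); apply: leq_addl.
elim/ltn_ind: m e' => m IHm {}e Pe.
have [Pe'|eP] := leqP (size P) e; first by rewrite nth_default //; apply: ideal0.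
have lt_d : ((size G).-1 < ((size G).-1 + e).+1)%N by rewrite ltnS leq_addr.
have := IGP ((size G).-1 + e)%N.
rewrite coefM (bigD1 (Ordinal lt_d)) // [nat_of_ord (Ordinal _)]/=.
rewrite (addKn (size G).-1 e) -/(lead_coef G) lG => IGPd.
suff IP : I (c%:MP * P`_e).
  by rewrite -[P`_e]scale1r -(mulVf c0) -scalerA -!mul_mpolyC; apply: idealM.
rewrite -(addrK (\sum_(i < ((size G).-1 + e).+1 | i != Ordinal lt_d)
    G`_i * P`_((size G).-1 + e - i)) (_ * P`_e)).
apply: idealB => //; apply: ideal_sum => // i.
rewrite -val_eqE /= neq_ltn => /orP[id | di]; last first.
  rewrite (_ : G`_i = 0) ?mul0r; first exact: ideal0.
  by apply: nth_default; apply: leq_trans di; apply: leqSpred.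
have [sP | Ps] := leqP (size P) ((size G).-1 + e - i).
  by rewrite (nth_default _ sP) mulr0; apply: ideal0.
apply: idealM => //; apply: (IHm (size P - ((size G).-1 + e - i))%N).
  by move: ((size G).-1) (size P) (nat_of_ord i) id Ps Pe eP => ? ? ?; lia.
by rewrite addnC subnK // ltnW.
Qed.

Lemma reg_monic_in k I g : is_ideal I -> free_of k I -> monic_in k g -> reg I g.
Proof.
move=> idI Ik [c c0 lg] a Iga.
rewrite -(uni_horner k a) horner_coef; apply: ideal_sum => // i _.
rewrite mulrC; apply: idealM => //; apply: coef_monicM c0 lg _ i => // e.
by rewrite -uniM; apply: Ik.
Qed.

Lemma free_of_addI k I g : is_ideal I -> free_of k I -> lacks k g ->
  free_of k (addI I g).
Proof.
move=> idI Ik /eqP gk p [c Ip] e; exists (uni k c)`_e.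
by have := Ik _ Ip e; rewrite uniB uniM gk coefB coefMC.
Qed.

(** The condition is triangular: adding a g that lacks the later variables keeps the ideal generated
    by polynomials free of them, so the later elements stay regular. *)
Lemma sreg_monic_in I (l : seq ('I_n * R)) : is_ideal I ->
  (forall k g, (k, g) \in l -> free_of k I /\ monic_in k g) ->
  pairwise (fun a b => lacks b.1 a.2) l -> sreg I (unzip2 l).
Proof.
elim: l I => //= -[k g] l IHl I idI l_ok /= /andP[/allP gl pl].
have [Ik gk] := l_ok k g (mem_head _ _).
split; first exact: reg_monic_in gk.
  by apply: IHl => // k' g' kg'; apply: l_ok; rewrite inE kg' orbT.
apply: IHl => //; first exact: is_ideal_addI.
move=> k' g' kg'; have [|Ik' gk'] := l_ok k' g'; first by rewrite inE kg' orbT.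
by split=> //; apply: free_of_addI => //; apply: (gl _ kg').
Qed.

Definition polyvar (F : {poly K}) (k : 'I_n) : R := (map_poly (@mpolyC n K) F).['X_k].

Lemma rmorph_polyvar (S : comNzRingType) (f : {rmorphism R -> S}) F k :
  f (polyvar F k) = (map_poly (f \o @mpolyC n K) F).[f 'X_k].
Proof. by rewrite /polyvar -horner_map -map_poly_comp. Qed.

Lemma uni_polyvar k i F : uni k (polyvar F i) =
  if i == k then map_poly (@mpolyC n K) F else (polyvar F i)%:P.
Proof.
transitivity ((map_poly (uni k \o @mpolyC n K) F).[uni k 'X_i]).
  exact: (rmorph_polyvar (uni k)).
have -> : map_poly (uni k \o @mpolyC n K) F = map_poly polyC (map_poly (@mpolyC n K) F).
  by rewrite -map_poly_comp; apply: eq_map_poly => c /=; rewrite uniC.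
rewrite uniX; case: eqP => _; last by rewrite horner_map.
by rewrite -/(_ \Po 'X) comp_polyXr.
Qed.

Lemma lacks_polyvar k i F : i != k -> lacks k (polyvar F i).
Proof. by move=> ik; rewrite /lacks uni_polyvar (negPf ik). Qed.

Lemma lacksB k p g : lacks k p -> lacks k g -> lacks k (p - g).
Proof. by rewrite /lacks uniB => /eqP-> /eqP->; rewrite polyCB. Qed.

Lemma monic_in_polyvarB k F g : F \is monic -> (1 < size F)%N -> lacks k g ->
  monic_in k (polyvar F k - g).
Proof.
move=> monF sF /eqP gk; exists 1; first exact: oner_neq0.
rewrite uniB uni_polyvar eqxx gk lead_coefDl.
  by rewrite lead_coef_map_eq (monicP monF) ?mpolyC1 ?oner_neq0.
by rewrite size_polyN size_map_poly_id0 ?(leq_ltn_trans (size_polyC_leq1 _)) //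
  (monicP monF) mpolyC1 oner_neq0.
Qed.

Lemma monic_inN k p : monic_in k p -> monic_in k (- p).
Proof.
move=> [c c0 lp]; exists (- c); first by rewrite oppr_eq0.
by rewrite -[- p]sub0r uniB rmorph0 sub0r lead_coefN lp mpolyCN.
Qed.

Lemma free_of_zero k : free_of k (fun p => p = 0).
Proof. by move=> p -> e; rewrite rmorph0 coef0. Qed.

End Univariate.

(** * Monomial ideals *)

Section MonomialIdeals.
Variables (K : fieldType) (n : nat).
Local Notation R := {mpoly K[n]}.
Implicit Types (D : 'X_{1..n} -> Prop) (m v : 'X_{1..n}).

Definition mono_ideal D : R -> Prop := fun p => forall m, m \in msupp p -> D m.

Definition up_closed D : Prop := forall m m', (m <= m')%MM -> D m -> D m'.

Lemma mono_idealX D m : mono_ideal D 'X_[m] <-> D m.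
Proof. by split=> [|Dm m']; [apply | ]; rewrite msuppX inE // => /eqP->. Qed.

Lemma is_ideal_mono D : up_closed D -> is_ideal (mono_ideal D).
Proof.
move=> upD; split.
- by move=> m; rewrite msupp0.
- by move=> a b Da Db m /msuppD_le; rewrite mem_cat => /orP[/Da|/Db].
- move=> a b Db m /msuppM_le /allpairsP[[m1 m2] /= [_ /Db Dm2 ->]].
  by apply: upD Dm2; apply: lem_addl.
Qed.

Lemma mono_ideal_ind D (I : R -> Prop) : is_ideal I ->
  (forall m, D m -> I 'X_[m]) -> forall p, mono_ideal D p -> I p.
Proof.
move=> idI DI p Dp; rewrite [p]mpolyE big_seq; apply: ideal_sum => // m mp.
by rewrite -mul_mpolyC; apply: idealM => //; apply/DI/Dp.
Qed.

Lemma colon_mono D k :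
  colon (mono_ideal D) 'X_k = mono_ideal (fun m => D (U_(k) + m)%MM).
Proof.
apply: pred_ext => p; rewrite /colon /mono_ideal; split=> Dp m mp.
  apply: Dp; rewrite mulrC (perm_mem (msuppMX _ _)).
  by apply/mapP; exists m.
by move: mp; rewrite mulrC (perm_mem (msuppMX _ _)) => /mapP[m' /Dp ? ->].
Qed.

Lemma addI_mono D k : up_closed D ->
  addI (mono_ideal D) 'X_k = mono_ideal (fun m => D m \/ m k != 0%N).
Proof.
move=> upD; have idD := is_ideal_mono upD.
have up' : up_closed (fun m => D m \/ m k != 0%N).
  move=> m m' mm' [Dm | mk]; [left; exact: upD Dm | right].
  by rewrite -lt0n (leq_trans _ (mnm_lepP mm' k)) // lt0n.
apply: pred_ext => p; split=> [[c Dp]|].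
  rewrite -(subrK (c * 'X_k) p); apply: (idealD (is_ideal_mono up')).
    by move=> m /Dp; left.
  apply: (idealM _ (is_ideal_mono up')).
  by apply/mono_idealX; right; rewrite mnm1E eqxx.
apply: mono_ideal_ind => [|m [Dm|mk]]; first exact: is_ideal_addI.
  by apply: addI_sub; apply/mono_idealX.
exists 'X_[m - U_(k)]; rewrite -mpolyXD submK ?subrr ?lep1mP //.
exact: ideal0.
Qed.

Lemma mono_ideal_ext D D' : (forall m, D m <-> D' m) ->
  mono_ideal D = mono_ideal D'.
Proof. by move=> DD'; congr mono_ideal; apply/funext => m; apply/propext. Qed.

Variables (q : nat) (u : 'I_q -> 'X_{1..n}) (s : seq R).
Implicit Types c : 'I_q -> 'X_{1..n}.

Definition coprime_mnms : Prop :=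
  forall i j k, u i k != 0%N -> u j k != 0%N -> i = j.

Definition div_by_some c m : Prop := exists i, (c i <= m)%MM.

Lemma up_div_by_some c : up_closed (div_by_some c).
Proof. by move=> m m' mm' [i cm]; exists i; apply: lepm_trans mm'. Qed.

Lemma up_div_by_some_or c v :
  up_closed (fun m => div_by_some c m \/ (v <= m)%MM).
Proof.
move=> m m' mm' [cm|vm]; first by left; apply: up_div_by_some cm.
by right; apply: lepm_trans mm'.
Qed.

Definition upd c i m : 'I_q -> 'X_{1..n} := fun j => if j == i then m else c j.

(** Invariant of the splitting: the c i inherit coprimality from the u i, and the variables left at
    the end form a transversal of the u i. *)
Definition supported c : Prop := forall i k, c i k != 0%N -> u i k != 0%N.

Lemma lem_U_add m m' k : (m <= U_(k) + m')%MM = (m - U_(k) <= m')%MM.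
Proof.
by apply/mnm_lepP/mnm_lepP => mm' i; have := mm' i;
  rewrite mnmDE mnmBE leq_subLR.
Qed.

Lemma lem_var m m' k : (m <= m')%MM -> m k != 0%N -> m' k != 0%N.
Proof. by move/mnm_lepP=> mm'; rewrite -!lt0n => /leq_trans; apply. Qed.

Lemma supported_upd c i m : supported c -> (forall k, m k != 0%N -> u i k != 0%N) ->
  supported (upd c i m).
Proof. by move=> cu mu j k; rewrite /upd; have [->|_] := eqVneq j i; [apply: mu|apply: cu]. Qed.

Hypothesis u_cop : coprime_mnms.

(** By coprimality x_k occurs in c i only, so the colon by x_k changes no other generator. *)
Lemma div_by_some_U c i k m : supported c -> c i k != 0%N ->
  div_by_some c (U_(k) + m) <-> div_by_some (upd c i (c i - U_(k))%MM) m.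
Proof.
move=> cu cik; split=> -[j cm]; exists j.
  rewrite /upd; have [<-|ji] := eqVneq j i; first by rewrite -lem_U_add.
  move: cm; rewrite lem_U_add; suff -> : (c j - U_(k))%MM = c j by [].
  apply/mnmP=> l; rewrite mnmBE mnm1E; case: eqP => [<-|_]; last by rewrite subn0.
  have [->//|cjk] := eqVneq (c j k) 0%N.
  by case/eqP: ji; apply: (@u_cop _ _ k); apply: cu.
move: cm; rewrite /upd lem_U_add; have [->//|_ cm] := eqVneq j i.
exact: lepm_trans (lem_subr _ _) cm.
Qed.

Lemma div_by_some_var c i k m : c i k != 0%N ->
  div_by_some c m \/ m k != 0%N <-> div_by_some (upd c i U_(k)%MM) m.
Proof.
move=> cik; split=> [[[j cm]|mk]|[j]].
- have [ji|ji] := eqVneq j i; last by exists j; rewrite /upd (negPf ji).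
  exists i; rewrite /upd eqxx lep1mP; apply: lem_var cm _.
  by rewrite ji.
- by exists i; rewrite /upd eqxx lep1mP.
- rewrite /upd; have [_|_] := eqVneq j i; first by rewrite lep1mP; right.
  by left; exists j.
Qed.

Hypothesis wreg_vars : forall t : 'I_q -> 'I_n, (forall i, u i (t i) != 0%N) ->
  wreg (mono_ideal (fun m => exists i, m (t i) != 0%N)) s.

Lemma wreg_mono1 D : up_closed D -> D 0%MM -> wreg (mono_ideal D) s.
Proof.
move=> upD D0; apply: wreg1; first exact: is_ideal_mono.
by rewrite -mpolyX0; apply/mono_idealX.
Qed.

(* Splitting off one variable of one c i reduces, along the exact sequences of
   [wreg_ext], to ideals generated by one variable from each block. *)
Lemma wreg_ci c : supported c -> wreg (mono_ideal (div_by_some c)) s.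
Proof.
have [N] := ubnP (\sum_i mdeg (c i)).
elim: N c => // N IHN c; rewrite ltnS => cN cu.
have [c0|c0] := pselect (exists i, c i = 0%MM).
  apply: wreg_mono1; first exact: up_div_by_some.
  by case: c0 => i ci; exists i; rewrite ci; apply: lepm_refl.
have [|big] := boolP [forall i, mdeg (c i) == 1%N].
  move=> /forallP c1; have /boolp.choice[t ct] : forall i, exists k, c i = U_(k)%MM.
    by move=> i; have /mdeg1P[k /eqP] := c1 i; exists k.
  rewrite (_ : div_by_some c = fun m => exists i, m (t i) != 0%N).
    by apply: wreg_vars => i; apply: cu; rewrite ct mnm1E eqxx.
  apply/funext => m; apply/propext.
  by split=> -[i cm]; exists i; move: cm; rewrite ct lep1mP.
(* Degree at least 2 makes the sum of degrees drop in both branches, where c i is divided by x_k or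
   replaced by x_k. *)
have [i ci] : exists i, (1 < mdeg (c i))%N.
  move: big; rewrite negb_forall => /existsP[i ci]; exists i.
  rewrite ltn_neqAle eq_sym ci lt0n mdeg_eq0; apply/eqP => ci0.
  by apply: c0; exists i.
have [k cik] : exists k, c i k != 0%N.
  apply: contrapT => c_0; apply: c0; exists i; apply/mnmP => k; rewrite mnm0E.
  by apply/eqP; apply: contrapT => /negP cik; apply: c_0; exists k.
have sumU m : (mdeg m < mdeg (c i) -> \sum_j mdeg (upd c i m j) < N)%N.
  move=> mci; apply: leq_trans cN; rewrite (bigD1 i) //= [X in (_ < X)%N](bigD1 i) //=.
  rewrite {1}/upd eqxx (eq_bigr (fun j => mdeg (c j))) ?ltn_add2r //.
  by move=> j ji; rewrite /upd (negPf ji).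
have upc := @up_div_by_some c.
apply: (@wreg_ext _ _ 'X_k); first exact: is_ideal_mono.
  rewrite colon_mono (mono_ideal_ext (fun m => div_by_some_U m cu cik)).
  apply: IHN; last first.
    apply: supported_upd => // l; rewrite mnmBE -lt0n => cl; apply: cu.
    by rewrite -lt0n; apply: leq_trans cl (leq_subr _ _).
  apply: sumU; rewrite -[X in (_ < mdeg X)%N](@submK n U_(k) (c i)) ?lep1mP //.
  by rewrite mdegD mdeg1 addn1.
rewrite addI_mono // (mono_ideal_ext (fun m => div_by_some_var m cik)).
apply: IHN; first by apply: sumU; rewrite mdeg1.
by apply: supported_upd => // l; rewrite mnm1E; have [<- _|//] := eqVneq k l; apply: cu.
Qed.

(** Divisibility puts each variable x_k of v into some c i. The colon by x_k divides v and this c i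
    by x_k and preserves divisibility; adding x_k makes v redundant and leaves a case of
    [wreg_ci]. *)
Lemma wreg_aci c v : supported c -> (forall k, v k <= \sum_i c i k)%N ->
  wreg (mono_ideal (fun m => div_by_some c m \/ (v <= m)%MM)) s.
Proof.
have [N] := ubnP (mdeg v); elim: N c v => // N IHN c v; rewrite ltnS => vN cu vc.
have upD := @up_div_by_some_or c v.
have [v0|/eqP v0] := eqVneq v 0%MM.
  by apply: wreg_mono1 => //; right; rewrite v0; apply: lepm_refl.
have [k vk] : exists k, v k != 0%N.
  apply: contrapT => v_0; apply: v0; apply/mnmP => k; rewrite mnm0E.
  by apply/eqP; apply: contrapT => /negP vk; apply: v_0; exists k.
have [i cik] : exists i, c i k != 0%N.
  apply: contrapT => c_0; case/eqP: vk; apply/eqP; rewrite -leqn0.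
  rewrite (leq_trans (vc k)) // big1 // => i _.
  by apply/eqP; apply: contrapT => /negP cik; apply: c_0; exists i.
apply: (@wreg_ext _ _ 'X_k); first exact: is_ideal_mono.
  rewrite colon_mono (@mono_ideal_ext _
    (fun m => div_by_some (upd c i (c i - U_(k))%MM) m \/ (v - U_(k) <= m)%MM)).
    apply: IHN.
    - apply: leq_trans vN; rewrite -[X in (_ < mdeg X)%N](@submK n U_(k) v) ?lep1mP //.
      by rewrite mdegD mdeg1 addn1.
    - apply: supported_upd => // l; rewrite mnmBE -lt0n => cl; apply: cu.
      by rewrite -lt0n; apply: leq_trans cl (leq_subr _ _).
    move=> l; rewrite (bigD1 i) //= /upd eqxx !mnmBE mnm1E.
    rewrite (eq_bigr (fun j => c j l)) => [|j ji]; last by rewrite (negPf ji).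
    have := vc l; rewrite (bigD1 i) //=; move: cik; case: eqP => [<-|_] /=; lia.
  by move=> m; rewrite -lem_U_add; split=> -[/(div_by_some_U _ cu cik)|]; auto.
rewrite addI_mono // (@mono_ideal_ext _ (div_by_some (upd c i U_(k)%MM))).
  apply: wreg_ci; apply: supported_upd => // l.
  by rewrite mnm1E; have [<- _|//] := eqVneq k l; apply: cu.
move=> m; rewrite -(div_by_some_var m cik); split=> [[[|vm]|]|[]]; auto.
by right; apply: lem_var vm vk.
Qed.

End MonomialIdeals.

(** * A regular sequence in a maximal ideal *)

Section ParameterSequence.
Variables (K : fieldType) (n q : nat) (u : 'I_q -> 'X_{1..n}).
Variables (F : 'I_n -> {poly K}) (b : 'I_q -> 'I_n).
Local Notation R := {mpoly K[n]}.
Hypothesis u_cop : coprime_mnms u.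
Hypothesis F_monic : forall k, F k \is monic.
Hypothesis F_size : forall k, (1 < size (F k))%N.
Hypothesis u_b : forall i, u i (b i) != 0%N.

(* One parameter per variable outside the range of b. Whichever variable of
   each block u i is set to zero, every parameter stays monic in a variable of
   its own. *)
Definition param (k : 'I_n) : R := polyvar (F k) k -
  (if [pick i | u i k != 0%N] is Some i then polyvar (F (b i)) (b i) else 0).

Definition params : seq R := [seq param k | k <- enum 'I_n & k \notin codom b].

Lemma pick_blockE i k : u i k != 0%N -> [pick j | u j k != 0%N] = Some i.
Proof.
move=> uik; case: pickP => [j ujk|/(_ i)]; last by rewrite uik.
by rewrite (u_cop ujk uik).
Qed.

Lemma lacks_param k l : k != l -> (forall i, u i k != 0%N -> b i != l) ->
  lacks l (param k).
Proof.
move=> kl bl; apply: lacksB; first exact: lacks_polyvar.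
case: pickP => [i /bl bil|_]; first exact: lacks_polyvar.
by rewrite /lacks -mpolyC0 uniC.
Qed.

Lemma b_inj : injective b.
Proof. by move=> i j bij; apply: (u_cop (u_b i)); rewrite bij u_b. Qed.

Lemma size_params : size params = (n - q)%N.
Proof.
have cb : count (mem (codom b)) (enum 'I_n) = q.
  by rewrite enumT -size_filter -[RHS](card_ord q) -(card_codom b_inj) cardE.
have := count_predC (mem (codom b)) (enum 'I_n).
rewrite cb size_enum_ord size_map size_filter => card_n.
by apply/eqP; rewrite -(eqn_add2l q) card_n subnKC // -card_n leq_addr.
Qed.

Lemma mono_ideal_vars (I : finType) (t : I -> 'I_n) :
  mono_ideal (fun m => exists i, m (t i) != 0%N) =
  adds (fun p : R => p = 0) [seq 'X_(t i) | i <- enum I].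
Proof.
set D := fun m : 'X_{1..n} => _.
have upD : up_closed D by move=> m m' mm' [i mi]; exists i; apply: lem_var mi.
have id0 := is_ideal_zero R.
apply: pred_ext => p; split.
  apply: mono_ideal_ind => [|m [i mi]]; first exact: is_ideal_adds.
  rewrite -(@submK _ U_(t i) m) ?lep1mP // mpolyXD.
  apply: (idealM _ (is_ideal_adds _ id0)); apply: adds_gen => //.
  by apply/mapP; exists i; rewrite ?mem_enum.
apply: adds_min p; first exact: is_ideal_mono.
  by move=> _ -> m; rewrite msupp0.
move=> y /mapP[i _ ->]; apply/mono_idealX.
by exists i; rewrite mnm1E eqxx.
Qed.

Lemma wreg_params (t : 'I_q -> 'I_n) : (forall i, u i (t i) != 0%N) ->
  wreg (mono_ideal (fun m => exists i, m (t i) != 0%N)) params.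
Proof.
move=> u_t; have id0 := is_ideal_zero R.
have neq i j k l : u i k != 0%N -> u j l != 0%N -> i != j -> k != l.
  by move=> uik ujl; apply: contraNneq => kl; rewrite (u_cop uik (j := j)) ?kl.
rewrite mono_ideal_vars; apply: sreg_wreg.
pose ts := [seq i <- enum 'I_q | t i != b i].
pose ks := [seq k <- enum 'I_n | (k \notin codom t) && (k \notin codom b)].
have uniq_ts : uniq ts by apply/filter_uniq/enum_uniq.
have uniq_ks : uniq ks by apply/filter_uniq/enum_uniq.
have perm_ks : perm_eq ([seq t i | i <- ts] ++ ks)
    [seq k <- enum 'I_n | k \notin codom b].
  apply: uniq_perm.
  - rewrite cat_uniq uniq_ks andbT; apply/andP; split.
      rewrite map_inj_uniq // => i j tij.
      by apply: (u_cop (u_t i)); rewrite tij u_t.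
    apply/hasPn => k; rewrite mem_filter => /andP[/andP[kt _] _].
    by apply: contra kt => /mapP[i _ ->]; apply: codom_f.
  - exact/filter_uniq/enum_uniq.
  move=> k; rewrite mem_cat [in RHS]mem_filter [k \in ks]mem_filter mem_enum !andbT.
  have [/codomP[i ki]|kt] /= := boolP (k \in codom t); last first.
    rewrite orbC; case: (_ \notin _) => //=; apply: contraNF kt.
    by move=> /mapP[i _ ->]; apply: codom_f.
  rewrite orbF; apply/mapP/idP => [[j]|kb].
    rewrite mem_filter => /andP[tbj _] ->; apply: contra tbj.
    move=> /codomP[l tl]; have [jl|jl] := eqVneq j l; first by rewrite tl jl.
    by have /eqP := neq _ _ _ _ (u_t j) (u_b l) jl.
  exists i => //; rewrite mem_filter mem_enum andbT; apply: contra kb => /eqP tb.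
  by rewrite ki tb codom_f.
(* The order matters: for k in ks, [param k] may contain x_(b i), in which [param (t i)] is monic up
   to sign, so ks comes last. The x_(t i) lead, to be absorbed into the ideal by [sreg_cat]. *)
pose l := [seq (t i, 'X_(t i) : R) | i <- enum 'I_q] ++
  [seq (b i, param (t i)) | i <- ts] ++ [seq (k, param k) | k <- ks].
suff sreg_l : sreg (fun p : R => p = 0) (unzip2 l).
  have -> : params = map param [seq k <- enum 'I_n | k \notin codom b] by [].
  apply: sreg_perm (perm_map param perm_ks) _ _ _; first exact: is_ideal_adds.
  move: sreg_l; rewrite /unzip2 !map_cat -!map_comp; exact: sreg_cat.
apply: sreg_monic_in => //.
  move=> k g; rewrite !mem_cat => /or3P[] /mapP[i is_i [-> ->]];
    (split; first exact: free_of_zero).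
  - by exists 1; rewrite ?oner_neq0 // uniX eqxx lead_coefX mpolyC1.
  - move: is_i; rewrite mem_filter => /andP[tb _].
    rewrite /param (pick_blockE (u_t i)) -opprB; apply: monic_inN.
    by apply: monic_in_polyvarB => //; apply: lacks_polyvar.
  - move: is_i; rewrite mem_filter => /andP[/andP[_ kb] _].
    apply: monic_in_polyvarB => //; case: pickP => [j _|_].
      by apply: lacks_polyvar; apply: contra kb => /eqP <-; apply: codom_f.
    by rewrite /lacks -mpolyC0 uniC.
have lacksX k j : j != k -> lacks k ('X_j : R).
  by move=> jk; rewrite /lacks uniX (negPf jk).
rewrite !pairwise_cat !pairwise_map; apply/and3P; split.
- rewrite allrel_catr; apply/andP; split; apply/allrelP => _ _ /mapP[i _ ->] /mapP[j + ->] /=;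
    rewrite mem_filter => /andP[jj _]; apply: lacksX.
    by have [->//|ij] := eqVneq i j; apply: neq ij.
  by case/andP: jj => jt _; apply: contraNneq jt => <-; apply: codom_f.
- apply: sub_pairwise (_ : pairwise [rel i j | i != j] _); last first.
    by rewrite -enumT -uniq_pairwise enum_uniq.
  by move=> i j /= ij; apply: lacksX; apply: neq ij.
apply/and3P; split.
- apply/allrelP => _ _ /mapP[i _ ->] /mapP[j + ->] /=.
  rewrite mem_filter => /andP[/andP[jt jb] _]; apply: lacks_param.
    by apply: contraNneq jt => <-; apply: codom_f.
  by move=> i' _; apply: contraNneq jb => <-; apply: codom_f.
- apply: sub_pairwise (_ : pairwise [rel i j | i != j] _); last first.
    by rewrite -uniq_pairwise.
  move=> i j /= ij; apply: lacks_param; first by apply: neq ij.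
  by move=> i' /(u_cop (u_t i)) <-; apply: neq ij.
apply: (@sub_in_pairwise _ (mem ks) [rel i j | i != j]); last first.
- by rewrite -uniq_pairwise.
- by apply/allP.
move=> k l' _ l'ks /= kl; have : l' \in ks by [].
rewrite mem_filter => /andP[/andP[_ lb] _].
apply: lacks_param => // i _; apply: contraNneq lb => <-; exact: codom_f.
Qed.

End ParameterSequence.

(** * Zariski's lemma *)

Section Zariski.
Variables (K : fieldType) (n : nat) (L : fieldType).
Local Notation R := {mpoly K[n]}.
Variable phi : {rmorphism R -> L}.
Implicit Types (S : {set 'I_n}) (p : R).

(* The projection of R onto K[x_i : i in S], which is encoded as its image. *)
Definition restr S : R -> R :=
  mmap (@mpolyC n K) (fun i => if i \in S then 'X_i else 0).

HB.instance Definition _ S := GRing.RMorphism.on (restr S).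

Lemma restrC S c : restr S c%:MP = c%:MP. Proof. exact: mmapC. Qed.
Lemma restrX S i : restr S 'X_i = if i \in S then 'X_i else 0.
Proof. by rewrite /restr mmapX mmap1U. Qed.
Lemma restrM S p p' : restr S (p * p') = restr S p * restr S p'.
Proof. exact: rmorphM. Qed.
Lemma restrD S p p' : restr S (p + p') = restr S p + restr S p'.
Proof. exact: rmorphD. Qed.
Lemma restr1 S : restr S 1 = 1. Proof. exact: rmorph1. Qed.
Lemma restrXn S p k : restr S (p ^+ k) = restr S p ^+ k.
Proof. exact: rmorphXn. Qed.

Definition indep S : Prop := forall p, phi (restr S p) = 0 -> restr S p = 0.

Lemma restr_set0 p : exists c, restr set0 p = c%:MP.
Proof.
pose f : R -> K := mmap (@idfun K) (fun=> 0); exists (f p).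
apply: (@mpoly_rmorph_eq K n R (restr set0) (@mpolyC n K \o f)) => [c|i] /=.
  by rewrite restrC /f mmapC.
by rewrite restrX inE /f mmapX mmap1U mpolyC0.
Qed.

Lemma restr_set1 k p : exists F, restr [set k] p = polyvar F k.
Proof.
pose f : R -> {poly K} := mmap (@polyC K) (fun i => if i == k then 'X else 0).
exists (f p).
pose g : {poly K} -> R := horner_eval 'X_k \o map_poly (@mpolyC n K).
apply: (@mpoly_rmorph_eq K n R (restr [set k]) (g \o f)) => [c|i] /=.
  by rewrite restrC /f /g mmapC /= /horner_eval map_polyC hornerC.
rewrite restrX inE /f /g mmapX mmap1U /horner_eval /=.
by have [->|_] := eqVneq i k; rewrite ?map_polyX ?hornerX ?rmorph0 ?horner0.
Qed.

Lemma restr_uni_coef S k p e :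
  restr S (uni k (restr (k |: S) p))`_e = (uni k (restr (k |: S) p))`_e.
Proof.
pose f : R -> {poly R} := map_poly (restr S) \o (uni k \o restr (k |: S)).
have := @mpoly_rmorph_eq K n {poly R} f (uni k \o restr (k |: S)).
move=> /(_ _ _ p)/wrap[c|i|] /=; last first.
  by move/(congr1 (fun P : {poly R} => P`_e)); rewrite coef_map.
- rewrite restrX; case: ifP => [|_]; last by rewrite [uni _ _]rmorph0 map_poly0.
  rewrite uniX !inE; have [->|_ iS] := eqVneq i k; first by rewrite map_polyX.
  by rewrite map_polyC /= restrX; move: iS => /= ->.
- by rewrite restrC uniC map_polyC /= restrC.
Qed.

Lemma indep_set0 : indep set0.
Proof.
move=> p; have [c ->] := restr_set0 p => phic; apply/eqP; rewrite mpolyC_eq0.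
by rewrite -(fmorph_eq0 (phi \o @mpolyC n K)) /= phic.
Qed.

Section Maximal.
Variable S : {set 'I_n}.
Hypothesis indS : indep S.
Let psi : R -> L := phi \o restr S.

HB.instance Definition _ := GRing.RMorphism.on psi.

Local Notation intg := (integralOver psi).

Lemma intg_fixed p : restr S p = p -> intg (phi p).
Proof. by move=> Sp; rewrite -Sp; apply: (integral_id psi). Qed.

(** A relation of degree d + 1 in x_k with leading coefficient b becomes monic in b x_k after
    multiplication by b ^ d. Degree 0 is excluded by the independence of S. *)
Lemma intg_lead k : ~ indep (k |: S) ->
  exists b, [/\ b != 0, restr S b = b & intg (phi (b * 'X_k))].
Proof.
move=> /existsNP[p0 /not_implyP[phip p_neq0]].
set p := restr _ p0 in phip p_neq0.
have fix_coef e : restr S (uni k p)`_e = (uni k p)`_e by apply: restr_uni_coef.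
move: (uni k p) (uni_horner k p) fix_coef => P Pp fix_coef.
have P0 : P != 0 by apply: contra_notN p_neq0 => /eqP P0; rewrite -Pp P0 horner0.
pose b := lead_coef P; exists b.
have fixb : restr S b = b by apply: fix_coef.
split; [by rewrite lead_coef_eq0 | exact: fixb |].
case defd: (size P).-1 => [|d].
  have defP : P = b%:P.
    by rewrite /b lead_coefE defd; apply/size1_polyC; move: defd; case: (size P) => [|[]].
  case/eqP: P0; rewrite defP; suff -> : b = 0 by rewrite polyC0.
  rewrite -fixb; apply: indS; rewrite fixb.
  by move: phip; rewrite -Pp defP hornerC.
have sP : size P = d.+2 by move: defd; case: (size P) => // m /= ->.
pose Q1 : {poly L} := \poly_(e < d.+1) phi (P`_e * b ^+ (d - e)).
pose Q : {poly L} := 'X^(d.+1) + Q1.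
have sQ : (size Q1 < size ('X^(d.+1) : {poly L}))%N.
  by rewrite size_polyXn ltnS size_poly.
apply: (@integral_root_monic _ _ _ _ Q).
- by rewrite monicE lead_coefDl // lead_coefXn.
- rewrite /root hornerD hornerXn horner_poly.
  have -> : phi (b * 'X_k) ^+ d.+1 +
      \sum_(i < d.+1) phi (P`_i * b ^+ (d - i)) * phi (b * 'X_k) ^+ i =
      phi (b ^+ d * P.['X_k]).
    rewrite horner_coef sP [in RHS]big_ord_recr /= mulrDr rmorphD addrC; congr (_ + _).
      rewrite mulr_sumr rmorph_sum; apply: eq_bigr => i _.
      rewrite -rmorphXn -rmorphM exprMn; congr (phi _).
      have -> : b ^+ d = b ^+ (d - i) * b ^+ i.
        by rewrite -exprD subnK // -ltnS ltn_ord.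
      by ring.
    rewrite -rmorphXn exprMn -[P`_d.+1](_ : b = _); last by rewrite /b lead_coefE sP.
    by rewrite exprSr -mulrA.
  by rewrite Pp rmorphM phip mulr0.
move=> x /(nthP 0)[i _ <-]; rewrite /Q /Q1 coefD coefXn coef_poly.
apply: integral_add; first exact: integral_nat.
case: ifP => _; last exact: integral0.
by apply: intg_fixed; rewrite restrM restrXn fix_coef fixb.
Qed.

Hypothesis maxS : forall k, k \notin S -> ~ indep (k |: S).

(** The product of the denominators of the finitely many variables serves for all p, since the p
    that become integral after multiplication by a power of it form a subring. *)
Lemma intg_denominator : exists b, [/\ b != 0, restr S b = b
  & forall p, exists N, intg (phi (b ^+ N * p))].
Proof.
have /boolp.choice[c cP] k : exists b,
    [/\ b != 0, restr S b = b & intg (phi (b * 'X_k))].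
  have [kS|/maxS] := boolP (k \in S); last exact: intg_lead.
  exists 1; rewrite oner_neq0 restr1 mul1r; split=> //.
  by apply: intg_fixed; rewrite restrX kS.
pose b := \prod_k c k; exists b.
have fixb : restr S b = b.
  rewrite /b [restr S _]rmorph_prod; apply: eq_bigr => k _.
  by case: (cP k).
have b0 : b != 0 by apply/prodf_neq0 => k _; case: (cP k).
have fixbN N : intg (phi (b ^+ N)) by apply: intg_fixed; rewrite restrXn fixb.
split=> //; pose good p := exists N, intg (phi (b ^+ N * p)).
have goodC a : good a%:MP.
  by exists 0%N; rewrite expr0 mul1r; apply: intg_fixed; rewrite restrC.
have goodM p p' : good p -> good p' -> good (p * p').
  move=> [N pN] [N' p'N]; exists (N + N')%N.
  by rewrite exprD mulrACA rmorphM; apply: integral_mul.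
have goodD p p' : good p -> good p' -> good (p + p').
  move=> [N pN] [N' p'N]; exists (N + N')%N.
  rewrite mulrDr rmorphD; apply: integral_add.
    by rewrite exprD mulrAC rmorphM mulrC; apply: integral_mul.
  by rewrite exprD -mulrA rmorphM; apply: integral_mul.
have goodX k : good 'X_k.
  exists 1%N; rewrite expr1 /b (bigD1 k) //= -mulrA mulrCA rmorphM.
  have [_ _ ck] := cP k; apply: integral_mul => //; apply: intg_fixed.
  by rewrite [restr S _]rmorph_prod; apply: eq_bigr => j _; case: (cP j).
have good1 : good 1 by rewrite -mpolyC1; apply: goodC.
have good0 : good 0 by rewrite -mpolyC0; apply: goodC.
move=> p; rewrite [p]mpolyE; apply: (big_ind good good0 goodD) => m _.
rewrite -mul_mpolyC mpolyXE_id; apply: (goodM) => //.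
apply: (big_ind good good1 goodM) => i _; elim: (m i) => [|e IHe] //.
by rewrite exprS; apply: goodM.
Qed.

Hypothesis phi_surj : forall y, exists p, phi p = y.

(* If x_s lies in a transcendence basis S, the inverse of c = 1 + x_s b in L is
   integral over K[x_S][1/b]. Hence c divides a power of b in K[x_S], although
   it is coprime to b and not constant. *)
Lemma maximal_indep_set0 : S = set0.
Proof.
apply/eqP/negP => /negP/set0Pn[s sS].
have [b [b0 fixb bint]] := intg_denominator.
pose c := 1 + 'X_s * b : R.
have fixc : restr S c = c by rewrite restrD restr1 restrM restrX sS fixb.
have sXb : (1 < msize ('X_s * b))%N.
  have Xs0 : 'X_s != 0 :> R by rewrite -msize_poly_eq0 msizeX.
  by rewrite msizeM // msizeX mdeg1 /= (mpolySpred _ b0).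
have c_big d : c <> d%:MP.
  move=> cd; move: sXb; rewrite (_ : 'X_s * b = (d - 1)%:MP).
    by rewrite msizeC; case: (_ == _).
  by rewrite mpolyCB mpolyC1 -cd /c addrAC subrr add0r.
have phic : phi c != 0.
  apply/eqP => phic; apply: (c_big 0); rewrite mpolyC0 -fixc; apply: indS.
  by rewrite fixc.
have [h phih] := phi_surj (phi c)^-1.
have [N [P monP rootP]] := bint h.
set d := (size P).-1.
have sP : size P = d.+1.
  by rewrite /d prednK // size_poly_gt0 monic_neq0.
(* Multiplying the integral equation of b ^ N / c by c ^ d clears the denominators; phi being
   injective on K[x_S], this becomes an identity of polynomials. *)
pose Q := \sum_(e < d) P`_e * c ^+ (d - e.+1) * b ^+ (N * e).
have bQ : b ^+ (N * d) + c * restr S Q = 0.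
  have -> : b ^+ (N * d) + c * restr S Q = restr S (b ^+ (N * d) + c * Q).
    by rewrite restrD restrM restrXn fixb fixc.
  apply: indS.
  have psiD : phi (restr S (b ^+ (N * d) + c * Q)) = psi (b ^+ (N * d)) + psi c * psi Q.
    by rewrite restrD restrM rmorphD rmorphM.
  have psiQ : psi Q = \sum_(e < d) psi P`_e * psi (c ^+ (d - e.+1)) * psi (b ^+ (N * e)).
    rewrite [psi Q]rmorph_sum; apply: eq_bigr => e _.
    by rewrite -!(rmorphM psi).
  have chb : phi c * phi (b ^+ N * h) = phi (b ^+ N).
    by rewrite rmorphM phih mulrCA mulfV // mulr1.
  have psic e : psi (c ^+ e) = phi c ^+ e.
    by rewrite /psi /= restrXn fixc rmorphXn.
  have psib e : psi (b ^+ e) = phi (b ^+ e) by rewrite /psi /= restrXn fixb.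
  transitivity (phi c ^+ d * (map_poly psi P).[phi (b ^+ N * h)]); last first.
    by rewrite (eqP rootP) mulr0.
  have sP' : size (map_poly psi P) = d.+1.
    by rewrite size_map_poly_id0 // -/(lead_coef P) (monicP monP) rmorph1 oner_neq0.
  rewrite horner_coef sP' big_ord_recr /= mulrDr psiD addrC; congr (_ + _).
    rewrite psiQ /= !mulr_sumr; apply: eq_bigr => e _.
    rewrite coef_map psic psib -[psi c]/(psi (c ^+ 1)) psic.
    rewrite exprM rmorphXn -chb exprMn.
    have -> : phi c ^+ d = phi c ^+ (d - e.+1) * phi c * phi c ^+ e.
      by rewrite -exprSr subnSK // -exprD subnK // ltnW.
    by rewrite expr1; ring.
  have -> : (map_poly psi P)`_d = 1.
    by rewrite coef_map -lead_coefE (monicP monP); apply: (rmorph1 psi).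
  rewrite mul1r -exprMn chb.
  by rewrite psib exprM rmorphXn.
(* With y = 1 - c = - x_s b, the geometric sum inverts c up to y ^ (N d), which [bQ] shows to be a
   multiple of c. *)
have [A cA] : exists A, c * A = 1.
  exists (\sum_(i < N * d) (- 'X_s * b) ^+ i + (- 'X_s) ^+ (N * d) * (- restr S Q)).
  rewrite mulrDr.
  have -> : c = 1 - (- 'X_s * b) by rewrite /c mulNr opprK.
  have /eqP := subrX1 (- 'X_s * b) (N * d); rewrite subr_eq => /eqP yE.
  move/eqP: bQ; rewrite addr_eq0 => /eqP bQ.
  rewrite -[RHS](subrK ((- 'X_s * b) ^+ (N * d))) {1}yE exprMn bQ /c.
  by ring.
have A0 : A != 0 by apply: contra_eq_neq cA => ->; rewrite mulr0 eq_sym oner_neq0.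
have c0 : c != 0 by apply: contra_eq_neq cA => ->; rewrite mul0r eq_sym oner_neq0.
have := congr1 (fun p : R => msize p) cA; rewrite /= msizeM // msize1.
rewrite (mpolySpred _ c0) (mpolySpred _ A0) addSn addnS /= => -[].
move/eqP; rewrite addn_eq0 => /andP[/eqP sc _].
have /msize1_polyC : (msize c <= 1)%N by rewrite (mpolySpred _ c0) sc.
exact: c_big.
Qed.

End Maximal.

Lemma zariski : (forall y, exists p, phi p = y) -> forall k, exists F : {poly K},
  [/\ F \is monic, (1 < size F)%N & phi (polyvar F k) = 0].
Proof.
move=> phi_surj k.
have ind0 : `[< indep set0 >] by apply/asboolP/indep_set0.
have [S /maxsetP[/asboolP indS maxS] _] := maxset_exists (P := fun S => `[< indep S >]) ind0.
have S0 : S = set0.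
  apply: (maximal_indep_set0 indS _ phi_surj) => l lS /asboolP /maxS eqS.
  by move/negP: lS; apply; rewrite -eqS ?subsetUr // setU11.
have /existsNP[p /not_implyP[phip p0]] : ~ indep [set k].
  move=> /asboolP /maxS; rewrite S0 sub0set => /(_ isT) /setP/(_ k).
  by rewrite !inE eqxx.
have [F Fp] := restr_set1 k p; rewrite {}Fp in phip p0.
have F0 : F != 0.
  by apply: contra_notN p0 => /eqP ->; rewrite /polyvar map_poly0 horner0.
have phiZ c : phi (polyvar (c *: F) k) = 0.
  by rewrite /polyvar map_polyZ hornerZ rmorphM phip mulr0.
exists ((lead_coef F)^-1 *: F); split=> //.
  by rewrite monicE lead_coefZ mulVf ?lead_coef_eq0.
rewrite size_scale ?invr_eq0 ?lead_coef_eq0 // ltnNge; apply/negP => /size1_polyC defF.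
apply: p0; rewrite /polyvar defF map_polyC hornerC /=.
have := phip; rewrite /polyvar defF map_polyC hornerC /= => /eqP.
rewrite -[phi _]/((phi \o @mpolyC n K) F`_0) fmorph_eq0 => /eqP F00.
by rewrite coefC eqxx F00 mpolyC0.
Qed.

End Zariski.

(** * Quotients and prime ideals *)

Section Quotients.

Lemma idealr_of_pred (A : comNzRingType) (I : A -> Prop) : is_ideal I -> ~ I 1 ->
  exists J : idealr A, forall x, x \in J <-> I x.
Proof.
move=> idI I1; pose S : {pred A} := fun x => `[< I x >].
have clS : idealr_closed S.
  split; [by apply/asboolP; apply: ideal0 | by apply/negP => /asboolP/I1 |].
  move=> a x y /asboolP Ix /asboolP Iy; apply/asboolP.
  by apply: idealD => //; apply: idealM.
exists (HB.pack_for (idealr A) S (isIdealr.Build A S clS)) => x.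
by split=> /asboolP.
Qed.

Lemma prime_idealr_of_pred (A : comNzRingType) (I : A -> Prop) : is_ideal I ->
  ~ I 1 -> (forall x y, I (x * y) -> I x \/ I y) ->
  exists P : prime_idealr A, forall x, x \in P <-> I x.
Proof.
move=> idI I1 primeI; have [J JI] := idealr_of_pred idI I1.
have prJ : prime_idealr_closed J.
  by move=> x y /JI/primeI[] /JI->; rewrite ?orbT.
by exists (HB.pack_for (prime_idealr A) (J : A -> bool)
  (Idealr.class J) (isPrimeIdealrClosed.Build A J prJ)).
Qed.

Lemma is_ideal_idealr (A : comNzRingType) (J : idealr A) : is_ideal (fun x => x \in J).
Proof.
split; [exact: idealr0 | by move=> a b; apply: rpredD |].
by move=> a b; apply: idealMr.
Qed.

Lemma pi_rmorphism (A : comNzRingType) (J : idealr A) :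
  exists f : {rmorphism A -> {ideal_quot J}},
  (forall y, exists x, f x = y) /\ (forall x, f x = 0 <-> x \in J).
Proof.
pose f : A -> {ideal_quot J} := \pi_{ideal_quot J}%qT.
have fB : zmod_morphism f by move=> x y; rewrite /f !piE.
have fM : monoid_morphism f by split=> [|x y]; rewrite /f !piE.
pose g := HB.pack_for {rmorphism A -> {ideal_quot J}} f
  (GRing.isZmodMorphism.Build _ _ f fB) (GRing.isMonoidMorphism.Build _ _ f fM).
exists g; split=> [y|x]; first by exists (repr y); rewrite /g /= /f reprK.
by rewrite /g /= /f; split=> [/eqP|xJ]; [|apply/eqP]; rewrite piE Quotient.equivE subr0.
Qed.

Lemma maximal_ideal_field (A : comNzRingType) (M : idealr A) : maximal_ideal M ->
  exists (L : fieldType) (f : {rmorphism A -> L}),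
  (forall y, exists x, f x = y) /\ (forall x, f x = 0 <-> x \in M).
Proof.
move=> maxM; have [f [f_surj f_ker]] := pi_rmorphism M.
have inv_ex (y : {ideal_quot M}) : exists z, (y != 0 -> z * y = 1) /\ (y = 0 -> z = 0).
  have [->|y0] := eqVneq y 0; first by exists 0.
  have [x fx] := f_surj y; have idM := is_ideal_idealr M.
  have [[c Mc]|M1] := pselect (addI (fun x => x \in M) x 1).
    exists (f c); split=> [_|y0']; last by rewrite y0' eqxx in y0.
    apply/eqP; rewrite -fx -rmorphM -subr_eq0 -(rmorph1 f) -rmorphB -opprB rmorphN oppr_eq0.
    exact/eqP/f_ker.
  have [J JE] := idealr_of_pred (is_ideal_addI x idM) M1.
  have: x \in M by apply: (maxM J) => [z Mz|]; apply/JE; [apply: addI_sub|apply: addI_gen].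
  by move/f_ker; rewrite fx => y0'; rewrite y0' eqxx in y0.
have [inv invP] := boolp.choice inv_ex.
have mulVf y : y != 0 -> inv y * y = 1 by case: (invP y).
have inv0 : inv 0 = 0 by case: (invP 0) => _; apply.
pose L := HB.pack_for fieldType (GRing.ComNzRing.sort {ideal_quot M})
  (GRing.ComNzRing_isField.Build {ideal_quot M} mulVf inv0).
by exists L, f.
Qed.

Lemma prime_idealr_ker (R A : comNzRingType) (D : idomainType)
  (pi : {rmorphism R -> A}) (f : {rmorphism R -> D}) :
  (forall a, exists p, pi p = a) -> (forall p, pi p = 0 -> f p = 0) ->
  exists P : prime_idealr A, forall p, pi p \in P <-> f p = 0.
Proof.
move=> pi_surj ker_pi.
have ker_eq p p' : pi p = pi p' -> f p = f p'.
  move=> pp'; apply/eqP; rewrite -subr_eq0 -rmorphB; apply/eqP/ker_pi.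
  by rewrite rmorphB pp' subrr.
have [||| P PE] := @prime_idealr_of_pred A (fun a => exists2 p, pi p = a & f p = 0).
- split.
  + by exists 0; rewrite rmorph0.
  + by move=> _ _ [p <- fp] [p' <- fp']; exists (p + p'); rewrite ?rmorphD // fp fp' addr0.
  + move=> a _ [p <- fp]; have [p' <-] := pi_surj a.
    by exists (p' * p); rewrite rmorphM // fp mulr0.
- move=> [p pip fp]; have /eqP := oner_neq0 D; apply.
  by rewrite -(rmorph1 f) -fp; apply: ker_eq; rewrite pip rmorph1.
- move=> a a' [p pip fp].
  have [x xa] := pi_surj a; have [x' xa'] := pi_surj a'.
  have /eqP : f (x * x') = 0 by rewrite -fp; apply: ker_eq; rewrite rmorphM xa xa' pip.
  by rewrite rmorphM mulf_eq0 => /orP[] /eqP ?; [left; exists x|right; exists x'].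
exists P => p; split=> [/PE[p' pp' <-]|fp]; first by apply: ker_eq.
by apply/PE; exists p.
Qed.

End Quotients.

(** * Chains of primes *)

Section PartialEvaluation.
Variables (K L : fieldType) (n : nat).
Local Notation R := {mpoly K[n]}.
Variable phi : {rmorphism R -> L}.
Implicit Types (S T : {set 'I_n}) (p : R).

(* The kernel of [peval S] is the prime generated by the intersection of ker phi
   with K[x_S]. *)
Definition peval S : R -> {mpoly L[n]} :=
  mmap (@mpolyC n L \o phi \o @mpolyC n K)
    (fun i => if i \in S then (phi 'X_i)%:MP else 'X_i).

HB.instance Definition _ S := GRing.RMorphism.on (peval S).

Lemma pevalC S c : peval S c%:MP = (phi c%:MP)%:MP. Proof. exact: mmapC. Qed.
Lemma pevalX S i : peval S 'X_i = if i \in S then (phi 'X_i)%:MP else 'X_i.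
Proof. by rewrite /peval mmapX mmap1U. Qed.

Lemma peval_setT p : peval setT p = (phi p)%:MP.
Proof.
apply: (@mpoly_rmorph_eq K n _ (peval setT) (@mpolyC n L \o phi)) => [c|i] /=.
  exact: pevalC.
by rewrite pevalX inE.
Qed.

Lemma peval_subset S S' p : S \subset S' -> peval S p = 0 -> peval S' p = 0.
Proof.
move=> /subsetP SS'.
pose e : {mpoly L[n]} -> {mpoly L[n]} :=
  mmap (@mpolyC n L) (fun i => if i \in S' then (phi 'X_i)%:MP else 'X_i).
have eS : e \o peval S =1 peval S'.
  apply: (@mpoly_rmorph_eq K n _ (e \o peval S) (peval S')) => [c|i] /=.
    by rewrite !pevalC [LHS]mmapC.
  rewrite !pevalX; case: ifP => iS; first by rewrite (SS' _ iS) [LHS]mmapC.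
  by rewrite [LHS]mmapX mmap1U.
by rewrite -eS /= => ->; apply: rmorph0.
Qed.

Lemma peval_polyvar S F k : F != 0 -> k \notin S -> peval S (polyvar F k) <> 0.
Proof.
move=> F0 kS.
have -> : peval S (polyvar F k) = polyvar (map_poly (phi \o @mpolyC n K) F) k.
  have -> := rmorph_polyvar (peval S) F k.
  rewrite /= pevalX (negPf kS) /polyvar -map_poly_comp; congr (_.[_]).
  by apply: eq_map_poly => c /=; rewrite pevalC.
set F' := map_poly _ F => F'k.
have : uni k (polyvar F' k) = 0 by rewrite F'k [LHS]rmorph0.
rewrite uni_polyvar eqxx => /eqP; rewrite map_poly_eq0_id0; last first.
  by rewrite mpolyC_eq0 lead_coef_eq0 /F' map_poly_eq0.
by rewrite /F' map_poly_eq0 (negPf F0).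
Qed.

Lemma peval_polyvar0 S F k : k \in S -> phi (polyvar F k) = 0 ->
  peval S (polyvar F k) = 0.
Proof.
move=> kS Fk; have -> : peval S (polyvar F k) = (phi (polyvar F k))%:MP.
  have -> := rmorph_polyvar (peval S) F k.
  rewrite -[RHS]/((@mpolyC n L \o phi) (polyvar F k)).
  rewrite [RHS](rmorph_polyvar (@mpolyC n L \o phi)) /= pevalX kS; congr (_.[_]).
  by apply: eq_map_poly => c /=; rewrite pevalC.
by rewrite Fk mpolyC0.
Qed.

Lemma peval_mono T S p : T \subset S -> (forall t, t \in T -> phi 'X_t = 0) ->
  mono_ideal (fun m => exists2 t, t \in T & m t != 0%N) p -> peval S p = 0.
Proof.
move=> /subsetP TS T0; apply: (mono_ideal_ind (I := fun p => peval S p = 0)).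
  split=> [|a b|a b]; first exact: rmorph0.
    by move=> a0 b0; rewrite [LHS]rmorphD /= a0 b0 addr0.
  by move=> b0; rewrite [LHS]rmorphM /= b0 mulr0.
move=> m [t tT mt]; rewrite -(@submK _ U_(t) m) ?lep1mP // mpolyXD.
by rewrite [LHS]rmorphM /= pevalX (TS _ tT) (T0 _ tT) mpolyC0 mulr0.
Qed.

Hypothesis phi_surj : forall y, exists p, phi p = y.
Variables (A : comNzRingType) (pi : {rmorphism R -> A}).
Hypothesis pi_surj : forall a, exists p, pi p = a.

(** T is enlarged by one variable at a time: when x_k joins, its polynomial F_k(x_k) from [zariski]
    enters the kernel, so the inclusion is strict. *)
Lemma chain_below_maximal T (P : prime_idealr A) :
  (forall t, t \in T -> phi 'X_t = 0) ->
  (forall p, pi p = 0 -> mono_ideal (fun m => exists2 t, t \in T & m t != 0%N) p) ->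
  (forall p, pi p \in P <-> phi p = 0) -> chain_below P (n - #|T|).
Proof.
move=> T0 kerT PE; pose e := enum (~: T).
pose S i := T :|: [set k in take i e].
have /boolp.choice[c cE] i : exists Q : prime_idealr A,
    forall p, pi p \in Q <-> peval (S i) p = 0.
  apply: (prime_idealr_ker (f := peval (S i))) => // p /kerT.
  by apply: peval_mono => //; apply: subsetUl.
have size_e : size e = (n - #|T|)%N.
  by rewrite -cardE cardsCs setCK card_ord.
exists c => [i ik|a].
  pose k0 : 'I_n := Ordinal (leq_trans ik (leq_subr _ _)).
  have ie : (i < size e)%N by rewrite size_e.
  have SS : S i \subset S i.+1.
    apply: setUS; apply/subsetP => k; rewrite !inE (take_nth k0) //.
    by rewrite mem_rcons inE => ->; rewrite orbT.
  split=> [a|].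
    by have [p <-] := pi_surj a => /cE/(peval_subset SS)/cE.
  move=> sub; pose k := nth k0 e i.
  have ke : k \in e by apply: mem_nth.
  have kS : k \notin S i.
    rewrite !inE negb_or in_take // index_uniq ?enum_uniq // ltnn andbT.
    by move: ke; rewrite mem_enum inE.
  have [F [monF sF Fk]] := zariski phi_surj k.
  apply: (@peval_polyvar (S i) F k) => //; first exact: monic_neq0.
  apply/cE/sub/cE; apply: peval_polyvar0 => //.
  by rewrite !inE (take_nth k0) // mem_rcons inE eqxx orbT.
have ST : S (n - #|T|)%N = setT.
  apply/setP => k; rewrite !inE -size_e take_size mem_enum inE orbN //.
have [p <-] := pi_surj a; apply/idP/idP => [/cE|/PE pP].
  by rewrite ST peval_setT => /eqP; rewrite mpolyC_eq0 => /eqP/PE.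
by apply/cE; rewrite ST peval_setT pP mpolyC0.
Qed.

End PartialEvaluation.

Section PrimeChains.
Variables (K : fieldType) (n : nat).
Local Notation R := {mpoly K[n]}.

Lemma prime_chain_tower (A : comNzRingType) (pi : {rmorphism R -> A}) k c :
  (forall a, exists p, pi p = a) -> @prime_chain A k c ->
  exists2 s : seq R, size s = k & tower (fun p => pi p \in c 0%N) s.
Proof.
move=> pi_surj; elim: k c => [|k IHk] c chain_c.
  by exists [::] => //=; rewrite rmorph1 idealr1.
have [|s sk tow] := IHk (fun i => c i.+1); first by move=> i ik; apply: (chain_c i.+1).
have [sub01 nsub10] := chain_c 0%N isT.
have [a [ca nca]] : exists a, a \in c 1%N /\ ~ a \in c 0%N.
  apply: contrapT => no_a; apply: nsub10 => a ca; apply: contrapT => nca.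
  by apply: no_a; exists a.
have [y ya] := pi_surj a; exists (y :: s); first by rewrite /= sk.
split=> [p|]; first by rewrite rmorphM prime_idealrM ya => /orP[].
exists (fun p => pi p \in c 1%N); split=> //; last by rewrite ya.
- split=> [|p p'|p p']; first by rewrite rmorph0 idealr0.
    by rewrite rmorphD; apply: rpredD.
  by rewrite rmorphM; apply: idealMr.
- by move=> p /sub01.
Qed.

Lemma prime_chain_size (A : comNzRingType) (pi : {rmorphism R -> A}) k c q D :
  (forall a, exists p, pi p = a) -> @prime_chain A k c ->
  (forall m, pi 'X_[m] != 0 -> exists2 T : {set 'I_n}, #|T| = q
     & forall t, t \in T -> (m t < D)%N) ->
  (k <= n - q)%N.
Proof.
move=> pi_surj chain_c std.
have [s <- tow] := prime_chain_tower pi_surj chain_c.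
apply: tower_size tow => //.
  split=> [|p p'|p p']; first by rewrite rmorph0 idealr0.
    by rewrite rmorphD; apply: rpredD.
  by rewrite rmorphM; apply: idealMr.
move=> m cm; apply: std; apply: contra_notN cm => /eqP ->; exact: idealr0.
Qed.

Lemma prime_idealr_vars (T : {set 'I_n}) :
  exists Q : prime_idealr R, forall p, p \in Q <-> restr (~: T) p = 0.
Proof.
apply: (prime_idealr_ker (pi := @idfun R) (f := @restr K n (~: T))).
  by move=> a; exists a.
by move=> p /= ->; apply: rmorph0.
Qed.

Lemma restr_var (T : {set 'I_n}) k : restr (~: T) ('X_k : R) = 0 <-> k \in T.
Proof.
rewrite restrX inE; case: (k \in T) => //; split=> // /eqP.
by rewrite -msize_poly_eq0 msizeX.
Qed.

Lemma restr_ideal (T : {set 'I_n}) (P : idealr R) :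
  (forall t, t \in T -> 'X_t \in P) -> forall p, restr (~: T) p = 0 -> p \in P.
Proof.
move=> TP p p0; have [f [_ f_ker]] := pi_rmorphism P.
apply/f_ker; rewrite -[RHS](rmorph0 f) -p0; apply/esym.
apply: (@mpoly_rmorph_eq K n _ (f \o restr (~: T)) f) => [c|i] /=.
  by rewrite restrC.
rewrite restrX inE; case: ifP => // /negbFE iT.
by rewrite rmorph0; apply/esym/f_ker/TP.
Qed.

Lemma restr_subset (S T : {set 'I_n}) (p : R) : S \subset T ->
  restr (~: S) p = 0 -> restr (~: T) p = 0.
Proof.
move=> /subsetP ST; have [Q QE] := prime_idealr_vars T.
move=> p0; apply/QE; apply: restr_ideal p0 => t tS; apply/QE/restr_var.
exact: ST.
Qed.

Lemma chain_below_vars (W : {set 'I_n}) (P : prime_idealr R) :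
  (forall w, w \in W -> 'X_w \in P) -> chain_below P #|W|.
Proof.
move=> WP; pose e := enum W; pose S i := [set k in take i e].
have [c cE] := boolp.choice (fun i => prime_idealr_vars (S i)).
have SW i : S i \subset W.
  by apply/subsetP => k; rewrite inE => /mem_take; rewrite mem_enum.
have size_e : size e = #|W| by rewrite -cardE.
(* P itself closes the chain, since it may be larger than the ideal generated by the variables of
   W. *)
exists (fun i => if (i < #|W|)%N then c i else P); last by rewrite ltnn.
move=> i iW; rewrite iW.
have [k0 _] : exists k, k \in W by apply/card_gt0P/(leq_trans _ iW).
have ie : (i < size e)%N by rewrite size_e.
pose k := nth k0 e i; have ke : k \in e by apply: mem_nth.
have kS : k \notin S i by rewrite inE in_take // index_uniq ?enum_uniq // ltnn.
have ck : ~ 'X_k \in c i by move=> /cE/restr_var; apply/negP.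
case: ltnP => [iW'|_].
  have SS : S i \subset S i.+1.
    by apply/subsetP => l; rewrite !inE (take_nth k0) // mem_rcons inE => ->; rewrite orbT.
  split=> [p /cE/(restr_subset SS)/cE //|sub]; apply/ck/sub/cE/restr_var.
  by rewrite inE (take_nth k0) // mem_rcons mem_head.
split=> [p /cE|sub].
  by apply: restr_ideal => t /(subsetP (SW i)); apply: WP.
by apply/ck/sub/WP; rewrite -mem_enum.
Qed.

(* A chain below (x_t : t in T) extends by the n - |T| other variables to a
   chain in R, whose length is at most n. *)
Lemma chain_below_vars_size (T : {set 'I_n}) (Q : prime_idealr R) k :
  (forall p, p \in Q <-> restr (~: T) p = 0) -> chain_below Q k -> (k <= #|T|)%N.
Proof.
move=> QE [c chain_c cQ]; pose e := enum (~: T).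
pose S i := T :|: [set l in take i e].
have [d dE] := boolp.choice (fun i => prime_idealr_vars (S i)).
have size_e : size e = (n - #|T|)%N by rewrite -cardE cardsCs setCK card_ord.
have Tn : (#|T| <= n)%N by rewrite -[n in (_ <= n)%N](card_ord n) max_card.
have cd : c k =i d 0%N.
  move=> p; rewrite cQ; have S0 : S 0%N = T.
    by apply/setP => l; rewrite !inE take0 orbF.
  by apply/idP/idP => [/QE|/dE]; rewrite ?S0 => H; [apply/dE; rewrite S0|apply/QE].
pose c' i := if (i <= k)%N then c i else d (i - k)%N.
have c'd i : (k <= i)%N -> c' i =i d (i - k)%N.
  by rewrite /c' leq_eqVlt => /orP[/eqP<-|ki]; rewrite ?leqnn ?subnn // leqNgt ki.
have chain_d : prime_chain (size e) d.
  move=> i ie.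
  have l0 : 'I_n by case: e @S ie {cd c'd c' dE size_e}.
  have SS : S i \subset S i.+1.
    apply: setUS; apply/subsetP => l; rewrite !inE (take_nth l0) //.
    by rewrite mem_rcons inE => ->; rewrite orbT.
  split=> [p /dE/(restr_subset SS)/dE //|sub].
  pose l := nth l0 e i; have le : l \in e by apply: mem_nth.
  have : 'X_l \in d i.
    apply/sub/dE/restr_var.
    by rewrite !inE (take_nth l0) // mem_rcons mem_head orbT.
  move=> /dE/restr_var; rewrite !inE in_take // index_uniq ?enum_uniq // ltnn orbF.
  by move: le; rewrite mem_enum inE => /negP.
have chain_c' : prime_chain (k + size e) c'.
  move=> i ik; have [ki|ki] := ltnP i k.
    by rewrite /c' ki ltnW //; apply: chain_c.
  have [|sub nsub] := chain_d (i - k)%N; first by rewrite ltn_subLR.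
  split=> [p|sub']; first by rewrite !c'd // ?subSn // 1?leqW //; apply: sub.
  by apply: nsub => p; rewrite -subSn // -!c'd // 1?leqW //; apply: sub'.
have : (k + size e <= n - 0)%N.
  apply: (@prime_chain_size R (@idfun R) _ _ 0 0 _ chain_c') => // [a|m _].
    by exists a.
  by exists set0; rewrite ?cards0 // => t; rewrite inE.
by rewrite size_e subn0; move: Tn; lia.
Qed.

End PrimeChains.

(** * Regular sequences of quotients *)

Section RegularSequences.
Variables (R A : comNzRingType) (pi : {rmorphism R -> A}).
Hypothesis pi_surj : forall a, exists p, pi p = a.
Let I := fun p : R => pi p = 0.

Lemma is_ideal_rker : is_ideal I.
Proof.
split; rewrite /I ?rmorph0 // => a b; first by rewrite rmorphD => -> ->; rewrite addr0.
by rewrite rmorphM => ->; rewrite mulr0.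
Qed.

Lemma in_ideal_cons (y : A) s x :
  in_ideal (y :: s) x <-> exists c, in_ideal s (x - c * y).
Proof.
split=> [[c ->]|[a [c xay]]].
  exists (c ord0); exists (fun i => c (lift ord0 i)).
  by rewrite big_ord_recl /= addrAC subrr add0r.
exists (fun i => if unlift ord0 i is Some j then c j else a).
rewrite big_ord_recl unlift_none -[LHS](subrK (a * y)) xay addrC; congr (_ + _).
by apply: eq_bigr => i _; rewrite liftK.
Qed.

Lemma in_ideal_adds s p : in_ideal (map pi s) (pi p) <-> adds I s p.
Proof.
elim: s p => [|y s IHs] p.
  split=> [[c]|p0]; first by rewrite big_ord0.
  by exists (fun=> 0); rewrite big_ord0.
rewrite adds_cons in_ideal_cons; split=> [[a]|[c /IHs]].
  have [c <-] := pi_surj a; rewrite -rmorphM -rmorphB => /IHs Ic.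
  by exists c.
by exists (pi c); rewrite -rmorphM -rmorphB.
Qed.

Lemma wregP (J : R -> Prop) s : wreg J s <->
  forall i, (i < size s)%N -> reg (adds J (take i s)) s`_i.
Proof.
elim: s J => [|y s IHs] J; first by split.
split=> [[reg_y /IHs wreg_s] [|i] //|regs]; first exact: wreg_s.
by split; [apply: (regs 0%N) | apply/IHs => i; apply: (regs i.+1)].
Qed.

Lemma regular_sequence_map s :
  regular_sequence (map pi s) <-> wreg I s /\ ~ adds I s 1.
Proof.
rewrite /regular_sequence -[1](rmorph1 pi) in_ideal_adds wregP size_map.
split=> -[regs s1]; split=> // i; last first.
  move=> a i_s; have [p <-] := pi_surj a.
  rewrite (nth_map 0) // -rmorphM -map_take !in_ideal_adds; exact: regs.
move=> i_s p; have := regs i (pi p) i_s.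
by rewrite (nth_map 0) // -rmorphM -map_take !in_ideal_adds.
Qed.

Lemma map_surj (s : seq A) : exists s', map pi s' = s.
Proof.
elim: s => [|a s [s' <-]]; first by exists [::].
by have [p <-] := pi_surj a; exists (p :: s').
Qed.

End RegularSequences.

(** * Minimal generators *)

Section MinimalGenerators.
Variables (K : fieldType) (n : nat).
Local Notation R := {mpoly K[n]}.
Implicit Types (I J : idealr R) (G H : seq 'X_{1..n}).

Definition divs G (m : 'X_{1..n}) : Prop := exists2 g, g \in G & (g <= m)%MM.

Lemma up_divs G : up_closed (divs G).
Proof. by move=> m m' mm' [g Gg gm]; exists g => //; apply: lepm_trans mm'. Qed.

Lemma in_ideal_mono G p :
  in_ideal [seq 'X_[m] | m <- G] p <-> mono_ideal (divs G) (p : R).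
Proof.
have idD := is_ideal_mono K (@up_divs G).
have id0 := is_ideal_zero R.
rewrite -[in X in X <-> _](map_id (map _ G)) -[in X in X <-> _]/(idfun p).
rewrite (@in_ideal_adds R R (@idfun R)) => [|a]; last by exists a.
split; last first.
  apply: mono_ideal_ind => [|m [g Gg gm]]; first exact: is_ideal_adds.
  rewrite -(submK gm) mpolyXD; apply: (idealM _ (is_ideal_adds _ id0)).
  by apply: adds_gen => //; apply: map_f.
apply: adds_min => // [p' /= -> m|y /mapP[g Gg ->]]; first by rewrite msupp0.
by apply/mono_idealX; exists g; rewrite ?lepm_refl.
Qed.

Lemma generated_byP G I : generated_by G I <->
  forall p, p \in I <-> mono_ideal (divs G) p.
Proof.
by split=> GI p; [rewrite -in_ideal_mono|rewrite in_ideal_mono]; apply: GI.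
Qed.

Lemma generated_byX G I m : generated_by G I -> 'X_[m] \in I <-> divs G m.
Proof. by move=> /generated_byP ->; apply: mono_idealX. Qed.

Lemma minimal_generators_antichain G I g g' : minimal_generators I G ->
  g \in G -> g' \in G -> (g <= g')%MM -> g = g'.
Proof.
move=> [uniqG genG minG] Gg Gg' gg'; apply: contrapT => /eqP neq.
have := minG [seq h <- G | h != g'] (mem_subseq (filter_subseq _ _)).
move=> /(_ _ g' Gg')/wrap[]; last by rewrite mem_filter eqxx.
apply/generated_byP => p; rewrite ((generated_byP _ _).1 genG).
rewrite (@mono_ideal_ext K n _ (divs [seq h <- G | h != g'])) // => m.
split=> [[h Gh hm]|[h]]; last by rewrite mem_filter => /andP[_]; exists h.
have [hg'|hg'] := eqVneq h g'; last by exists h; rewrite // mem_filter hg'.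
exists g; first by rewrite mem_filter neq.
by apply: lepm_trans hm; rewrite hg'.
Qed.

Lemma lepm_anti (m m' : 'X_{1..n}) : (m <= m')%MM -> (m' <= m)%MM -> m = m'.
Proof.
move=> /mnm_lepP mm' /mnm_lepP m'm; apply/mnmP => i.
by apply/eqP; rewrite eqn_leq mm' m'm.
Qed.

Lemma antichain_generators_unique G H I :
  generated_by G I -> generated_by H I ->
  (forall g g', g \in G -> g' \in G -> (g <= g')%MM -> g = g') ->
  (forall g g', g \in H -> g' \in H -> (g <= g')%MM -> g = g') -> G =i H.
Proof.
suff sub G' H' : generated_by G' I -> generated_by H' I ->
    (forall g g', g \in G' -> g' \in G' -> (g <= g')%MM -> g = g') ->
    {subset G' <= H'}.
  by move=> gG gH aG aH g; apply/idP/idP; apply: sub.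
move=> gG gH aG g Gg.
have /(generated_byX _ gH)[h Hh hg] : 'X_[g] \in I.
  by apply/(generated_byX _ gG); exists g; rewrite ?lepm_refl.
have /(generated_byX _ gG)[g' Gg' g'h] : 'X_[h] \in I.
  by apply/(generated_byX _ gH); exists h; rewrite ?lepm_refl.
have g'g := aG _ _ Gg' Gg (lepm_trans g'h hg).
by rewrite (lepm_anti (m := g) (m' := h)) // -g'g.
Qed.

End MinimalGenerators.

(** * The Koszul class of a dominant ideal *)

Section DominantKoszul.
Variables (K : fieldType) (n p : nat).
Local Notation R := {mpoly K[n]}.
Variables (w : 'I_p -> 'X_{1..n}) (b : 'I_p -> 'I_n) (i0 : 'I_p).
Hypothesis w_dom : forall i j, j != i -> (w j (b i) < w i (b i))%N.
Hypothesis w_b : forall i, w i (b i) != 0%N.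

(** Variables are divided into classes by a generator in which their exponent is largest; [B k] is
    the only dominating variable in the class of k. The [deg k] are the exponents of the lcm of the
    w i. *)
Let top (k : 'I_n) : 'I_p := [arg max_(i > i0) w i k].
Let deg (k : 'I_n) : nat := w (top k) k.
Let B (k : 'I_n) : 'I_n := b (top k).

Let deg_ge i k : (w i k <= deg k)%N.
Proof. by rewrite /deg /top; case: arg_maxnP => // j _; apply. Qed.

Let top_b i : top (b i) = i.
Proof.
apply: contraTeq isT => /w_dom.
by rewrite ltnNge deg_ge.
Qed.

Let b_inj : injective b.
Proof. by move=> i j bij; rewrite -(top_b i) bij top_b. Qed.

(** Linear forms generating the irrelevant ideal, chosen so that all but the dominating variables
    vanish under [fold]. *)
Definition dom_var (k : 'I_n) : R := if k == B k then 'X_k else 'X_k - 'X_(B k).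

(** The lcm of the w i divided by the product of the dominating variables. *)
Let m0 : 'X_{1..n} := [multinom (deg k - (k \in codom b))%N | k < n].
Let S0 : {set 'I_n} := [set k in codom b].

Let fold : R -> R := mmap (@mpolyC n K) (fun k => 'X_(B k)).

HB.instance Definition _ := GRing.RMorphism.on fold.

Let foldX m : fold 'X_[m] = 'X_[\sum_k U_(B k) *+ m k].
Proof.
rewrite [LHS]mmapX (big_morph _ (@mpolyXD n K) (@mpolyX0 n K)); apply: eq_bigr => k _.
by rewrite mpolyXn.
Qed.

Let fold_deg m i : (\sum_k U_(B k) *+ m k)%MM (b i) = \sum_(k | top k == i) m k.
Proof.
rewrite mnm_sumE (bigID (fun k => top k == i)) /= [X in (_ + X)%N]big1 ?addn0.
  by apply: eq_bigr => k /eqP ki; rewrite mulmnE mnm1E /B ki eqxx mul1n.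
by move=> k ki; rewrite mulmnE mnm1E /B (inj_eq b_inj) (negPf ki).
Qed.

(* m0 times the wedge of the dominating variables is the Koszul cycle given
   by the top syzygy of the Taylor resolution. Identifying each variable with
   the dominating variable of its class kills the remaining generators
   [dom_var k] but not the monomial m0, so this cycle is not a boundary. *)
Lemma dominant_koszul :
  koszul_nonzero dom_var (mono_ideal (fun m => exists i, (w i <= m)%MM)) p.
Proof.
set D := fun m => exists i, _.
have upD : up_closed D by move=> m m' mm' [i wm]; exists i; apply: lepm_trans mm'.
have idD := is_ideal_mono K upD.
have cardS0 : #|S0| = p by rewrite cardsE card_codom // card_ord.
exists (fun S => if S == S0 then 'X_[m0] else 0); split.
- by move=> S Sp; rewrite ifN //; apply: contraNneq Sp => ->; rewrite cardS0.
- move=> S; apply: ideal_sum => // j jS; case: eqP => [jSS0|_]; last first.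
    by rewrite mulr0; apply: ideal0.
  have : j \in S0 by rewrite -jSS0 setU11.
  rewrite inE => /codomP[i ji].
  rewrite -mulrA; apply: (idealM _ idD).
  have -> : dom_var j = 'X_j by rewrite /dom_var /B ji top_b eqxx.
  (* m0 x_(b i) is a multiple of w i: the exponent at b i is restored, and at any other b l that of
     w i is below the maximum, so losing one is harmless. *)
  rewrite -mpolyXD; apply/mono_idealX; exists i; apply/mnm_lepP => k.
  rewrite mnmDE mnm1E mnmE ji; have [<-|kbi] := eqVneq (b i) k.
    by rewrite codom_f subnKC ?deg_ge // (leq_trans _ (deg_ge i _)) ?lt0n.
  rewrite add0n; have [/codomP[l kl]|_] := boolP (k \in codom b); last by rewrite subn0.
  rewrite {}kl (inj_eq b_inj) in kbi *.
  have := @w_dom l i; rewrite kbi => /(_ isT); rewrite -{2}(top_b l) -/(deg (b l)).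
  by case: (deg (b l)) => // d; rewrite ltnS subn1.
move=> t /(_ S0); rewrite eqxx.
(* [fold] collects the class of i at b i, where w i reaches the full sum of the [deg k] and m0 stays
   one short. *)
pose D' m := exists i, (\sum_(k | top k == i) deg k <= m (b i))%N.
have upD' : up_closed D'.
  by move=> m m' /mnm_lepP mm' [i im]; exists i; apply: leq_trans (mm' _).
have idD' := is_ideal_mono K upD'.
have fold_sub x : mono_ideal D x -> mono_ideal D' (fold x).
  apply: (mono_ideal_ind (I := fun x => mono_ideal D' (fold x))).
    split=> [|x1 x2|x1 x2].
    - by rewrite [fold 0]rmorph0; apply: (ideal0 idD').
    - by rewrite [fold (_ + _)]rmorphD; apply: (idealD idD').
    - by rewrite [fold (_ * _)]rmorphM; apply: (idealM _ idD').
  move=> m [i /mnm_lepP wm]; rewrite foldX; apply/mono_idealX; exists i.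
  by rewrite fold_deg; apply: leq_sum => k /eqP ki; rewrite /deg ki.
move/fold_sub; rewrite [fold _]rmorphB /=.
have -> : fold (kbd dom_var t S0) = 0.
  rewrite [LHS]rmorph_sum big1 //= => j jS0.
  have -> : dom_var j = 'X_j - 'X_(B j).
    by rewrite /dom_var ifN //; apply: contraNneq jS0 => ->; rewrite inE /B codom_f.
  have fX k : fold 'X_k = 'X_(B k) by rewrite [LHS]mmapX mmap1U.
  have fM x y : fold (x * y) = fold x * fold y by apply: rmorphM.
  have fB x y : fold (x - y) = fold x - fold y by apply: rmorphB.
  rewrite !fM fB !fX.
  by rewrite /B top_b subrr mulr0 mul0r.
rewrite subr0 foldX => /mono_idealX[i]; rewrite fold_deg leqNgt => /negP; apply.
rewrite (bigD1 (b i)) ?top_b //= [X in (_ < X)%N](bigD1 (b i)) ?top_b //=.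
rewrite -addSn leq_add //; last by apply: leq_sum => k _; rewrite mnmE leq_subr.
rewrite mnmE codom_f subn1 prednK // (leq_trans _ (deg_ge i _)) // lt0n.
exact: w_b.
Qed.

Lemma dom_var_span (x : R) : x@_0%MM = 0 -> exists c, x = \sum_k c k * dom_var k.
Proof.
pose I (x : R) := exists c, x = \sum_k c k * dom_var k.
have idI : is_ideal I.
  split=> [|_ _ [c ->] [d ->]|a _ [c ->]].
  - by exists (fun=> 0); rewrite big1 // => k _; rewrite mul0r.
  - exists (fun k => c k + d k); rewrite -big_split /=.
    by apply: eq_bigr => k _; rewrite mulrDl.
  - exists (fun k => a * c k); rewrite mulr_sumr.
    by apply: eq_bigr => k _; rewrite mulrA.
have Idom k : I (dom_var k).
  exists (fun j => (j == k)%:R); rewrite (bigD1 k) //= eqxx mul1r big1 ?addr0 //.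
  by move=> j jk; rewrite (negPf jk) mul0r.
have IX k : I 'X_k.
  have [kB|kB] := eqVneq k (B k).
    by have := Idom k; rewrite /dom_var -kB eqxx.
  have := Idom k; rewrite /dom_var (negPf kB) => Ik.
  rewrite -(subrK 'X_(B k) 'X_k); apply: idealD => //.
  by have := Idom (B k); rewrite /dom_var /B top_b eqxx.
move=> x0; rewrite -/(I x); apply: (@mono_ideal_ind K n (fun m => m != 0%MM)) => //.
  move=> m; rewrite -mdeg_eq0 mdegE sum_nat_eq0 => /forall_inPn[k _ mk].
  by rewrite -(@submK _ U_(k) m) ?lep1mP // mpolyXD; apply: idealM.
by move=> m; rewrite mcoeff_msupp; apply: contraNneq => ->; rewrite x0.
Qed.

End DominantKoszul.

(** * Almost complete intersections *)

Section AlmostCompleteIntersection.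
Variables (K : fieldType) (n q : nat).
Local Notation R := {mpoly K[n]}.
Implicit Types (I J : idealr R) (T W : {set 'I_n}).

Lemma mono_ideal_sub J T p : (forall t, t \in T -> 'X_t \in J) ->
  mono_ideal (fun m => exists2 t, t \in T & m t != 0%N) p -> p \in J.
Proof.
move=> TJ; apply: (mono_ideal_ind (is_ideal_idealr J)) => m [t tT mt].
by rewrite -(@submK _ U_(t) m) ?lep1mP // mpolyXD; apply/idealMr/TJ.
Qed.

Lemma prime_idealrX (P : prime_idealr R) m : 'X_[m] \in P ->
  exists2 k, 'X_k \in P & m k != 0%N.
Proof.
move=> Pm; apply: contrapT => noP; move/negP: Pm; apply.
have notPM x y : x \notin P -> y \notin P -> x * y \notin P.
  by move=> xP yP; rewrite prime_idealrM negb_or xP.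
have notP1 : 1 \notin P by rewrite idealr1.
rewrite mpolyXE_id; apply/negP.
apply: (big_ind (fun x : R => x \notin P) notP1 notPM) => k _.
case mk: (m k) => [|e] //; have Xk : 'X_k \notin P.
  by apply/negP => Xk; apply: noP; exists k; rewrite ?mk.
by elim: (e.+1) => // d IHd; rewrite exprS; apply: notPM.
Qed.

Variables (I : idealr R) (u : q.-tuple 'X_{1..n}) (v : 'X_{1..n}).

Lemma divs_rcons m : divs (rcons u v) m <-> div_by_some (tnth u) m \/ (v <= m)%MM.
Proof.
split=> [[g]|[[i um]|vm]].
- rewrite mem_rcons inE => /orP[/eqP->|/tnthP[i ->]]; first by right.
  by left; exists i.
- by exists (tnth u i); rewrite // mem_rcons inE mem_tnth orbT.
- by exists v; rewrite // mem_rcons mem_head.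
Qed.

Hypothesis aci : almost_complete_intersection I u v.

Let minI : minimal_generators I (rcons u v). Proof. by case: aci. Qed.
Let genI : generated_by (rcons u v) I. Proof. by case: minI. Qed.

Lemma aci_notin : v \notin u.
Proof. by have [] := minI; rewrite rcons_uniq => /andP[]. Qed.

Lemma aci_uniq : uniq u.
Proof. by have [] := minI; rewrite rcons_uniq => /andP[]. Qed.

Lemma aci_supp g : g \in rcons u v -> exists k, g k != 0%N.
Proof.
move=> Gg; apply: contrapT => g0.
have : 'X_[g] \in I by apply/(generated_byX _ genI); exists g; rewrite ?lepm_refl.
suff -> : g = 0%MM by rewrite mpolyX0 idealr1.
apply/mnmP => k; rewrite mnm0E; apply/eqP; apply: contrapT => /negP gk.
by apply: g0; exists k.
Qed.

Lemma tnth_rcons i : tnth u i \in rcons u v.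
Proof. by rewrite mem_rcons inE mem_tnth orbT. Qed.

(** A variable common to two of the u_i could serve both, so fewer than q variables would generate a
    prime containing all the u_i, of height below q. *)
Lemma aci_coprime : coprime_mnms (tnth u).
Proof.
have [_ _ [J genJ [G minJ [_ heightJ]]]] := aci.
have [uniqG genG _] := minJ.
have sizeG : size G = q.
  rewrite -(size_tuple u); apply/perm_size/uniq_perm => //; first exact: aci_uniq.
  apply: (antichain_generators_unique genG genJ) => g g' Gg Gg'.
    exact: (minimal_generators_antichain minJ).
  by apply: (minimal_generators_antichain minI); rewrite mem_rcons inE (Gg, Gg') orbT.
have /boolp.choice[t0 t0P] i := aci_supp (tnth_rcons i).
move=> i j k uik ujk; apply: contrapT => /eqP ij.
pose t l := if (l == i) || (l == j) then k else t0 l.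
have tP l : tnth u l (t l) != 0%N.
  rewrite /t; have [->|_] := eqVneq l i; first by [].
  by have [->|_] := eqVneq l j; last exact: t0P.
pose T := t @: [set: 'I_q].
have cardT : (#|T| < q)%N.
  have := leq_imset_card t [set: 'I_q]; rewrite cardsT card_ord leq_eqVlt.
  case/orP=> // /eqP cardT; case/eqP: ij.
  have /imset_injP inj_t : #|t @: [set: 'I_q]| == #|[set: 'I_q]|.
    by rewrite cardsT card_ord cardT.
  by apply: inj_t; rewrite ?inE // /t !eqxx orbT.
have [Q QE] := prime_idealr_vars K T.
have /(chain_below_vars_size QE) : chain_below Q (size G).
  apply: heightJ => p /((generated_byP _ _).1 genJ) Jp.
  apply: (@mono_ideal_sub Q T) => [l lT|m /Jp[g /tnthP[i' ->] um]].
    exact/QE/restr_var.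
  by exists (t i'); [apply: imset_f | apply: lem_var um _].
by rewrite sizeG leqNgt cardT.
Qed.

Lemma transversal_inj (t : 'I_q -> 'I_n) :
  (forall i, tnth u i (t i) != 0%N) -> injective t.
Proof.
by move=> tP i j tij; apply: (aci_coprime (tP i)); rewrite tij.
Qed.

(** A prime of height q over I contains at most q variables. One from each u_i, distinct by
    coprimality, already make q, so the variable of v in this prime is among them. *)
Lemma aci_transversal : exists t : 'I_q -> 'I_n,
  (forall i, tnth u i (t i) != 0%N) /\ exists i, v (t i) != 0%N.
Proof.
have [_ [[P IP [_ Pmax]] _] _] := aci.
pose W := [set k | ('X_k : R) \in P].
have cardW : (#|W| <= q)%N.
  by apply/Pmax/chain_below_vars => w; rewrite inE.
have hitW g : g \in rcons u v -> exists2 k, k \in W & g k != 0%N.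
  move=> Gg; have [|k Pk gk] := @prime_idealrX P g; last by exists k; rewrite ?inE.
  by apply/IP/(generated_byX _ genI); exists g; rewrite ?lepm_refl.
have /boolp.choice[t tP] i : exists k, k \in W /\ tnth u i k != 0%N.
  by have [k ? ?] := hitW _ (tnth_rcons i); exists k.
exists t; have tu i : tnth u i (t i) != 0%N by case: (tP i).
split=> //; have Wt : t @: [set: 'I_q] = W.
  apply/eqP; rewrite eqEcard card_imset ?cardsT ?card_ord ?cardW ?andbT.
    by apply/subsetP => _ /imsetP[i _ ->]; case: (tP i).
  exact: transversal_inj.
have [|k] := hitW v; first by rewrite mem_rcons mem_head.
by rewrite -Wt => /imsetP[i _ ->]; exists i.
Qed.

Lemma leq_sum_tnth i k : (tnth u i k <= \sum_j tnth u j k)%N.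
Proof. by rewrite (bigD1 i) //= leq_addr. Qed.

(** Each u_i has a dominating variable in any case: one in which it exceeds v, which exists as u_i
    does not divide v, occurs in no other u_j. So dominance only depends on v. *)
Lemma not_dominant_le : ~ dominant I -> forall k, (v k <= \sum_i tnth u i k)%N.
Proof.
move=> ndom k; rewrite leqNgt; apply/negP => vk; apply: ndom.
exists (rcons u v) => // m; rewrite mem_rcons inE => /orP[/eqP->|/tnthP[i ->]].
  exists k => m'; rewrite mem_rcons inE => /orP[/eqP->|/tnthP[j ->] _].
    by rewrite eqxx.
  exact: leq_ltn_trans (leq_sum_tnth j k) vk.
have [l vl] : exists l, (v l < tnth u i l)%N.
  apply: contrapT => uv; move/negP: aci_notin; apply.
  suff <- : tnth u i = v by apply: mem_tnth.
  apply: (minimal_generators_antichain minI (tnth_rcons i)).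
    by rewrite mem_rcons mem_head.
  by apply/mnm_lepP => l; rewrite leqNgt; apply/negP => ?; apply: uv; exists l.
exists l => m'; rewrite mem_rcons inE => /orP[/eqP-> //|/tnthP[j ->] ji].
have uil : tnth u i l != 0%N by rewrite -lt0n (leq_ltn_trans _ vl).
have [->|ujl] := eqVneq (tnth u j l) 0%N; first by rewrite lt0n.
by rewrite (aci_coprime ujl uil) eqxx in ji.
Qed.

Let w := tnth [tuple of rcons u v].

Lemma dominant_vars : dominant I -> exists b : 'I_q.+1 -> 'I_n,
  forall i j, j != i -> (w j (b i) < w i (b i))%N.
Proof.
move=> [G minG domG].
suff /boolp.choice[b bP] i : exists k, forall j, j != i -> (w j k < w i k)%N.
  by exists b.
have [uniq_uv _ _] := minI; have [_ genG _] := minG.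
have GE : G =i rcons u v.
  apply: (antichain_generators_unique genG genI) => g g' Gg Gg'.
    exact: (minimal_generators_antichain minG).
  exact: (minimal_generators_antichain minI).
have [|k kP] := domG (w i); first by rewrite GE mem_tnth.
exists k => j ji; apply: kP; first by rewrite GE mem_tnth.
by rewrite (inj_eq (tuple_uniqP _ uniq_uv)).
Qed.

Lemma divs_rcons_tnth m : divs (rcons u v) m <-> exists i, (w i <= m)%MM.
Proof.
split=> [[g /(tnthP [tuple of rcons u v])[i ->]] gm|[i wm]]; first by exists i.
by exists (w i); rewrite // mem_tnth.
Qed.

Variable pi : {rmorphism R -> {ideal_quot I}}.
Hypothesis pi_surj : forall a, exists p, pi p = a.
Hypothesis pi_ker : forall p, pi p = 0 <-> p \in I.

Let kerE : (fun p => pi p = 0) = mono_ideal (divs (rcons u v)).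
Proof. by apply: pred_ext => p; rewrite pi_ker; apply: (generated_byP _ _).1. Qed.

Lemma ker_transversal (t : 'I_q -> 'I_n) p :
  (forall i, tnth u i (t i) != 0%N) -> (exists i, v (t i) != 0%N) ->
  pi p = 0 ->
  mono_ideal (fun m => exists2 k, k \in t @: [set: 'I_q] & m k != 0%N) p.
Proof.
move=> tP [i0 vt]; rewrite -[_ = 0]/((fun p => pi p = 0) p) kerE => Ip m /Ip.
move=> /divs_rcons[[i um]|vm].
  by exists (t i); [apply: imset_f | apply: lem_var um _].
by exists (t i0); [apply: imset_f | apply: lem_var vm _].
Qed.

Lemma card_transversal (t : 'I_q -> 'I_n) :
  (forall i, tnth u i (t i) != 0%N) -> #|t @: [set: 'I_q]| = q.
Proof.
by move=> tP; rewrite card_imset ?cardsT ?card_ord //; apply: transversal_inj.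
Qed.

(** A monomial outside I is divisible by no u_i, so for each i some variable has a smaller exponent
    in it than in u_i; coprimality makes these q variables distinct. *)
Lemma standard_monomials : exists D, forall m, pi 'X_[m] != 0 ->
  exists2 T : {set 'I_n}, #|T| = q & forall t, t \in T -> (m t < D)%N.
Proof.
exists (\max_i \max_k tnth u i k)%N => m /eqP Xm.
have /boolp.choice[t tP] i : exists k, (m k < tnth u i k)%N.
  apply: contrapT => mu; apply: Xm.
  rewrite -[_ = 0]/((fun p => pi p = 0) 'X_[m]) kerE; apply/mono_idealX.
  apply/divs_rcons; left; exists i; apply/mnm_lepP => k.
  by rewrite leqNgt; apply/negP => ?; apply: mu; exists k.
exists (t @: [set: 'I_q]).
  by apply: card_transversal => i; rewrite -lt0n (leq_ltn_trans _ (tP i)).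
move=> _ /imsetP[i _ ->]; apply: leq_trans (tP i) _.
apply: leq_trans (leq_bigmax i); exact: leq_bigmax.
Qed.

Lemma regular_sequence_size (s : seq {ideal_quot I}) :
  regular_sequence s -> (size s <= n - q)%N.
Proof.
have [s' <-] := map_surj pi_surj s.
move=> /(regular_sequence_map pi_surj)[wreg_s s1]; rewrite size_map.
have [D std] := standard_monomials; have idI := is_ideal_rker pi.
apply: (tower_size idI _ (wreg_tower idI wreg_s s1)) => m Xm.
by apply: std; apply/eqP.
Qed.

Lemma maximal_ideal_eq (M : idealr {ideal_quot I}) (P : prime_idealr {ideal_quot I}) :
  maximal_ideal M -> {subset M <= P} -> P =i M.
Proof. by move=> maxM MP a; apply/idP/idP => [/(maxM P MP)|/MP]. Qed.

Lemma cohen_macaulay_aci : (forall k, v k <= \sum_i tnth u i k)%N ->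
  cohen_macaulay {ideal_quot I}.
Proof.
move=> v_le M maxM.
have [L [f [f_surj f_ker]]] := maximal_ideal_field maxM.
pose phi : {rmorphism R -> L} := f \o pi.
have phi_surj y : exists p, phi p = y.
  by have [a <-] := f_surj y; have [p <-] := pi_surj a; exists p.
have phi_gen g : g \in rcons u v -> exists2 k, phi 'X_k = 0 & g k != 0%N.
  move=> Gg; apply: contrapT => no_k.
  have /eqP : phi 'X_[g] = 0.
    rewrite /phi /= (_ : pi _ = 0) ?rmorph0 //; apply/pi_ker.
    by apply/(generated_byX _ genI); exists g; rewrite ?lepm_refl.
  rewrite mpolyXE_id rmorph_prod; apply/negP/prodf_neq0 => k _.
  rewrite rmorphXn; case gk: (g k) => [|e]; first by rewrite expr0 oner_neq0.
  by apply/expf_neq0/eqP => Xk; apply: no_k; exists k; rewrite ?gk.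
have [|k0 phi_k0 vk0] := phi_gen v; first by rewrite mem_rcons mem_head.
have /boolp.choice[t0 t0P] i : exists k, phi 'X_k = 0 /\ tnth u i k != 0%N.
  by have [k ? ?] := phi_gen _ (tnth_rcons i); exists k.
have [i0 ui0] : exists i, tnth u i k0 != 0%N.
  apply: contrapT => uk0; case/negP: vk0; rewrite -leqn0 (leq_trans (v_le k0)) //.
  rewrite big1 // => i _; apply/eqP; apply: contrapT => /negP uik.
  by apply: uk0; exists i.
(* Choosing a variable of v for block i0 makes the x_(t i) generate an ideal that contains v as well
   as the u_i, while phi still kills it. *)
pose t i := if i == i0 then k0 else t0 i.
have tP i : tnth u i (t i) != 0%N.
  by rewrite /t; have [->//|_] := eqVneq i i0; case: (t0P i).
have vt : exists i, v (t i) != 0%N by exists i0; rewrite /t eqxx.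
pose T := t @: [set: 'I_q].
have phiT k : k \in T -> phi 'X_k = 0.
  by move=> /imsetP[i _ ->]; rewrite /t; case: eqP => _ //; case: (t0P i).
have chainP (P : prime_idealr {ideal_quot I}) : P =i M -> chain_below P (n - q).
  move=> PM; rewrite -(card_transversal tP).
  apply: (chain_below_maximal phi_surj pi_surj phiT) => p.
    exact: ker_transversal.
  by rewrite PM -f_ker.
have [P PE] := prime_idealr_ker (f := phi) pi_surj
  (fun p p0 => etrans (congr1 f p0) (rmorph0 f)).
have PM : P =i M.
  move=> a; have [p <-] := pi_surj a.
  by apply/idP/idP => [/PE/f_ker|/f_ker/PE].
have [D std] := standard_monomials.
exists (n - q)%N.
  split=> [|Q MQ]; last by apply/chainP/maximal_ideal_eq.
  exists P => [a|]; first by rewrite PM.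
  split; first exact: chainP.
  move=> k [c chain_c _]; exact: (prime_chain_size pi_surj chain_c std).
split; last by move=> s [_]; apply: regular_sequence_size.
have /boolp.choice[F FP] k := zariski phi_surj k.
have F_monic k : F k \is monic by case: (FP k).
have F_size k : (1 < size (F k))%N by case: (FP k).
have F_phi k : phi (polyvar (F k) k) = 0 by case: (FP k).
pose s := params (tnth u) F t.
have s_phi y : y \in s -> phi y = 0.
  move=> /mapP[k _ ->]; rewrite rmorphB F_phi sub0r.
  by case: pickP => [i _|_]; rewrite ?F_phi ?rmorph0 oppr0.
exists (map pi s); last first.
  by rewrite size_map; apply: size_params => //; apply: aci_coprime.
split=> [_ /mapP[y ys ->]|]; first exact/f_ker/s_phi.
apply/regular_sequence_map => //; split.
  rewrite kerE (mono_ideal_ext _ divs_rcons).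
  apply: (wreg_aci aci_coprime) => // t' t'P.
  by apply: wreg_params => //; apply: aci_coprime.
move=> s1; have /eqP := oner_neq0 L; apply; rewrite -(rmorph1 phi).
apply: (adds_min (J := fun p => phi p = 0) _ _ s_phi s1).
  exact: is_ideal_rker.
by move=> p p0; rewrite /phi /= p0 rmorph0.
Qed.

Lemma not_dominant_aci : cohen_macaulay {ideal_quot I} -> ~ dominant I.
Proof.
move=> cm /dominant_vars[b b_dom].
have [t [tP vt]] := aci_transversal.
have [i1 _] := vt.
(* The kernel of the constant coefficient is the irrelevant ideal, which the [dom_var k]
   generate. *)
pose phi : {rmorphism R -> K} := mcoeff 0%MM.
have phiX k : phi 'X_k = 0 by rewrite /phi /= mcoeffX mnm1_eq0.
have phi_surj y : exists p, phi p = y by exists y%:MP; apply: mpolyCK.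
have phi_ker p : pi p = 0 -> phi p = 0.
  move=> /(ker_transversal tP vt); apply: (mono_ideal_ind (is_ideal_rker phi)).
  by move=> m [k _ mk]; rewrite -(@submK _ U_(k) m) ?lep1mP // mpolyXD rmorphM phiX mulr0.
have [M ME] := prime_idealr_ker (f := phi) pi_surj phi_ker.
have maxM : maximal_ideal M.
  move=> J MJ a Ja; have [p pa] := pi_surj a; rewrite -pa in Ja *; apply/ME.
  apply/eqP; apply: contraFT (idealr1 J) => phip.
  have M_sub : pi (p - (phi p)%:MP) \in M.
    by apply/ME; rewrite rmorphB [phi _%:MP]mpolyCK subrr.
  have Jphi : pi (phi p)%:MP \in J.
    by rewrite -[_%:MP](subKr p) rmorphB rpredB // MJ.
  rewrite -(rmorph1 pi) -mpolyC1 -(mulVf phip) mpolyCM rmorphM; exact: idealMr.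
have [h [[P MP [_ Pmax]] _] [[s [sM regs] sh] _]] := cm M maxM.
have nqh : (n - q <= h)%N.
  apply: Pmax; rewrite -(card_transversal tP).
  apply: (chain_below_maximal phi_surj pi_surj) => // p.
    exact: ker_transversal.
  by rewrite (maximal_ideal_eq maxM MP) ME.
have [s' def_s] := map_surj pi_surj s.
move: regs sM sh; rewrite -def_s => /(regular_sequence_map pi_surj)[wreg_s _] sM.
rewrite size_map => sh.
(* [i1] shows that q is positive, so each generator has another one to exceed and its dominating
   exponent is nonzero. *)
have w_b i : w i (b i) != 0%N.
  have [j ji] : exists j, j != i.
    have [->|i0] := eqVneq i ord0; last by exists ord0; rewrite eq_sym.
    by exists (lift ord0 i1); rewrite eq_sym neq_lift.
  by rewrite -lt0n (leq_ltn_trans _ (b_dom _ _ ji)).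
have kos := dominant_koszul K ord0 b_dom w_b.
have : (q.+1 + size s' <= n)%N.
  rewrite -(mono_ideal_ext K divs_rcons_tnth) -kerE in kos.
  apply: (koszul_bound (is_ideal_rker pi) _ wreg_s kos).
  by move=> y ys; apply: dom_var_span => //; apply/ME/sM/map_f.
by move: nqh; rewrite -sh; lia.
Qed.

End AlmostCompleteIntersection.

Theorem proposition1p10 (K : fieldType) (n q : nat)
    (I : idealr {mpoly K[n]}) (u : q.-tuple 'X_{1..n}) (v : 'X_{1..n}) :
  almost_complete_intersection I u v ->
  cohen_macaulay {ideal_quot I} <-> ~ dominant I.
Proof.
move=> aci; have [pi [pi_surj pi_ker]] := pi_rmorphism I; split.
  exact: (not_dominant_aci aci pi_surj pi_ker).
by move/(not_dominant_le aci); apply: (cohen_macaulay_aci aci pi_surj pi_ker).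
Qed.
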